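(* Let $d$ be a (pseudo)metric on $\mathcal R(\Omega,\mathcal X)$ and $(\mathbf X^s,\mathbf U^s)$ a stationary pair with $|\ell(\mathbf X^s,\mathbf U^s)|<\infty$. Assume: (1) the optimal control problem is strictly stochastically dissipative at $(\mathbf X^s,\mathbf U^s)$ with respect to $d$, with storage function $\lambda$ and $\alpha\in\mathcal K_\infty$; (2) there is $r>0$ such that $\lambda$ is uniformly bounded on $\bar B^d_r(\mathbf X^s)$ and $\mathbf X^s$ is cheaply reachable on $\bar B^d_r(\mathbf X^s)$ with constant $C_V$; (3) there exist $\varepsilon>0$ and $\gamma_V:\mathbb R_{\ge0}\times\mathbb R_{\ge0}\to\mathbb R_{\ge0}$ with $\gamma_V(N,\rho)\to0$ as $N\to\infty$ and $\rho\to0$, and with $\gamma_V(\cdot,\rho)$, $\gamma_V(N,\cdot)$ monotone for fixed $\rho$ and $N$, such that $|V_N(j,X_j)-V_N(j,X^s(j))|\le\gamma_V(N,d(X_j,X^s(j)))$ for all $N\in\mathbb N$, $j\in\mathbb N_0$, $X_j\in\bar B^d_\varepsilon(X^s(j))$; (4) $\tilde\ell(j,X^s(j),U^s(j))=0$ for all $j\in\mathbb N_0$; (5) there exist $\tilde r\ge\tilde\varepsilon>0$ and $\gamma_\lambda,\gamma_{\tilde V}\in\mathcal K_\infty$ such that for all $N\in\mathbb N$, $j\in\mathbb N_0$: $|\lambda(j,X_j)-\lambda(j,X^s(j))|\le\gamma_\lambda(d(X_j,X^s(j)))$ for all $X_j\in\bar B^d_{\tilde\varepsilon}(X^s(j))$,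 and $|\tilde V_N(j,X_j)-\tilde V_N(j,X^s(j))|\le\gamma_{\tilde V}(d(X_j,X^s(j)))$ for all $X_j\in\bar B^d_{\tilde r}(X^s(j))$; (6) there exist $\hat\varepsilon>0$ and $\gamma_{V_\infty}\in\mathcal K$ such that $|\hat V_\infty(j,X_j)-\hat V_\infty(j,X^s(j))|\le\gamma_{V_\infty}(d(X_j,X^s(j)))$ for all $j\in\mathbb N_0$, $X_j\in\bar B^d_{\hat\varepsilon}(X^s(j))$. With $\vartheta(L):=\alpha^{-1}\big((C_\lambda+C_\lambda^l+C_V)/L\big)$, where $C_\lambda$ is a uniform bound of $|\lambda|$ on $\bar B^d_r(\mathbf X^s)$ and $-C^l_\lambda$ a uniform lower bound of $\lambda$ ($C_\lambda,C_\lambda^l>0$), set $$\nu(N):=8\gamma_{\tilde V}\big(\vartheta(\tfrac N{12})\big)+4\gamma_\lambda\big(\vartheta(\tfrac N{12})\big)+4\gamma_V\big(\tfrac N2,\vartheta(\tfrac N{12})\big).$$ Then there exist $\theta_0>0$, $N_0\in\mathbb N$, $\delta\in\mathcal L$, $\beta\in\mathcal{KL}$ and $\delta_2,\delta_3\in\mathcal L$ which have the properties (P1)–(P3) listed in the context and for which, moreover, for all sufficiently large $N$ and all $X_0\in\tilde V_N^{-1}(0,[0,\theta_0])$, $$\liminf_{K\to\infty}\bigg(\sum_{j=0}^{K-1}\Big(\ell(X_{\mathbf U}(j;0,X_0),U(j))-\ell\big(X_{\mu_N}(j;0,X_0),\mu_N(X_{\mu_N}(j;0,X_0))\big)\Big)+K\nu(N)+\delta_2(N)\bigg)\ge0$$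 for all $\mathbf U\in\mathbb U_{ad}^\infty(0,X_0)$.
   Context: Setting. $\mathcal X,\mathcal U,\mathcal W$ are separable Banach spaces, $f:\mathcal X\times\mathcal U\times\mathcal W\to\mathcal X$ is continuous, $(\Omega,\mathcal F,\mathbb P)$ is a probability space, and for $\mathcal Z\in\{\mathcal X,\mathcal U,\mathcal W\}$, $\mathcal R(\Omega,\mathcal Z)$ is the set of measurable maps $(\Omega,\mathcal F)\to(\mathcal Z,\mathcal B(\mathcal Z))$. $W(0),W(1),\dots\in\mathcal R(\Omega,\mathcal W)$ are i.i.d. with distribution $P_W$; throughout, the noise acting at any time is independent of the state and the control at that time. $\mathbb U\subseteq\mathcal U$ is a control constraint set. $g:\mathcal X\times\mathcal U\to\mathbb R$ is lower semicontinuous and bounded from below, and $\ell(X,U):=\mathbb E[g(X,U)]$. Optimal control problem. For $j\in\mathbb N_0$, $X_j\in\mathcal R(\Omega,\mathcal X)$ and a control sequence $\mathbf U=(U(0),U(1),\dots)$, $X_{\mathbf U}(0;j,X_j)=X_j$, $X_{\mathbf U}(k+1;j,X_j)=f(X_{\mathbf U}(k;j,X_j),U(k),W(j+k))$. $\mathbb U_{ad}(X):=\{U\in\mathcal R(\Omega,\mathcal U):\sigma(U)\subseteq\sigma(X),\ U(\omega)\in\mathbb U\ \forall\omega\}$; $\mathbb U^N_{ad}(j,X_j)$ ($N\in\mathbb N\cup\{\infty\}$) is the set of control sequences with $U(k)\in\mathbb U_{ad}(X_{\mathbf U}(k;j,X_j))$ for all $0\le k\le N-1$. $J_N(j,X_j,\mathbf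 U):=\sum_{k=0}^{N-1}\ell(X_{\mathbf U}(k;j,X_j),U(k))$, $V_N(j,X_j):=\inf_{\mathbf U\in\mathbb U^N_{ad}(j,X_j)}J_N(j,X_j,\mathbf U)$, $V_0\equiv0$. Minimizers are denoted $\mathbf U^*_{N}=\mathbf U^*_{N,j,X_j}$; minimizers are assumed to exist whenever they are referred to. MPC feedback: $\mu_N(X_j):=U^*_{N,j,X_j}(0)$, the first element of an optimal control sequence at time $j$ and state $X_j$ (any choice of minimizer). $X_{\mu_N}(\cdot;j_0,X_{j_0})$ is the closed-loop trajectory started at time $j_0$ in $X_{j_0}$ (first argument: elapsed steps): $X_{\mu_N}(0;j_0,X_{j_0})=X_{j_0}$, $X_{\mu_N}(j+1;j_0,X_{j_0})=f(X,\mu_N(X),W(j_0+j))$ with $X=X_{\mu_N}(j;j_0,X_{j_0})$. $J_K^{cl}(X_0,\mu_N):=\sum_{j=0}^{K-1}\ell(X_{\mu_N}(j;0,X_0),\mu_N(X_{\mu_N}(j;0,X_0)))$. A family $\mathcal Y(j)\subseteq\mathcal R(\Omega,\mathcal X)$ is forward invariant if $f(X_j,\mu_N(X_j),W(j))\in\mathcal Y(j+1)$ for all $X_j\in\mathcal Y(j)$, $j\in\mathbb N_0$. Stationary pair: processes $(\mathbf X^s,\mathbf U^s)$ with $X^s(k+1)=f(X^s(k),U^s(k),W(k))$, $\mathbf U^s\in\mathbb U^\infty_{ad}(0,X^s(0))$, such that the laws of $X^s(k)$, $U^s(k)$ and $(X^s(k),U^s(k))$ do not depend on $k\in\mathbb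 N_0$; $\ell(\mathbf X^s,\mathbf U^s)$ denotes the constant value $\ell(X^s(k),U^s(k))$. (Pseudo)metrics $d:\mathcal R(\Omega,\mathcal X)^2\to[0,\infty]$ may take the value $\infty$. $\bar B^d_r(X^s(j)):=\{X\in\mathcal R(\Omega,\mathcal X):d(X,X^s(j))\le r\}$, $\bar B^d_r(\mathbf X^s):=\{(j,X_j):j\in\mathbb N_0,\ X_j\in\bar B^d_r(X^s(j))\}$. Comparison functions on $[0,\infty)$: $\mathcal K$: continuous, strictly increasing, zero at $0$; $\mathcal K_\infty$: unbounded functions in $\mathcal K$; $\mathcal L$: continuous, strictly decreasing to $0$; $\mathcal{KL}$: continuous $\beta:[0,\infty)^2\to[0,\infty)$ with $\beta(\cdot,t)\in\mathcal K$ for all $t$ and $\beta(s,\cdot)\in\mathcal L$ for all $s$. Strict stochastic dissipativity at $(\mathbf X^s,\mathbf U^s)$ w.r.t. $d$: there are a storage function $\lambda:\mathbb N_0\times\mathcal R(\Omega,\mathcal X)\to\mathbb R$, uniformly bounded from below, and $\alpha\in\mathcal K_\infty$ with $$\tilde\ell(j,X,U):=\ell(X,U)-\ell(\mathbf X^s,\mathbf U^s)+\lambda(j,X)-\lambda(j+1,f(X,U,W(j)))\ge\alpha(d(X,X^s(j)))$$ for all $j\in\mathbb N_0$, $X\in\mathcal R(\Omega,\mathcal X)$, $U\in\mathbb U_{ad}(X)$. Cheap reachability on $\bar B^d_r(\mathbf X^s)$ with constant $C_V>0$: $V_N(j,X_j)-N\ell(\mathbf X^s,\mathbf U^s)\le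 C_V$ for all $(j,X_j)\in\bar B^d_r(\mathbf X^s)$, $N\in\mathbb N$. Modified problem: $\tilde J_N(j,X_j,\mathbf U):=\sum_{k=0}^{N-1}\tilde\ell(j+k,X_{\mathbf U}(k;j,X_j),U(k))$, $\tilde V_N(j,X_j):=\inf_{\mathbf U\in\mathbb U^N_{ad}(j,X_j)}\tilde J_N(j,X_j,\mathbf U)$, $\tilde V_N^{-1}(j,[0,a]):=\{X\in\mathcal R(\Omega,\mathcal X):\tilde V_N(j,X)\in[0,a]\}$. Shifted problem: $\hat\ell(X,U):=\ell(X,U)-\ell(\mathbf X^s,\mathbf U^s)$, $\hat J_N(j,X_j,\mathbf U):=\sum_{k=0}^{N-1}\hat\ell(X_{\mathbf U}(k;j,X_j),U(k))$ and $\hat V_N(j,X_j):=\inf_{\mathbf U\in\mathbb U^N_{ad}(j,X_j)}\hat J_N(j,X_j,\mathbf U)$ for $N\in\mathbb N\cup\{\infty\}$ (infinite sums are limits of partial sums). Uniform time-varying Lyapunov function on $\mathcal S(j)\subseteq\mathcal R(\Omega,\mathcal X)$, $j\in\mathbb N_0$: a function $V:\{(j,X_j):j\in\mathbb N_0,X_j\in\mathcal S(j)\}\to[0,\infty)$ for which there are $\alpha_1,\alpha_2\in\mathcal K_\infty$, $\alpha_V\in\mathcal K$ such that (i) $\alpha_1(d(X_j,X^s(j)))\le V(j,X_j)\le\alpha_2(d(X_j,X^s(j)))$ and (ii) $V(j+1,f(X_j,\mu_N(X_j),W(j)))\le V(j,X_j)-\alpha_V(d(X_j,X^s(j)))$ hold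 for all $j\in\mathbb N_0$ and all $X_j\in\mathcal S(j)$ with $f(X_j,\mu_N(X_j),W(j))\in\mathcal S(j+1)$. Properties of $\theta_0,N_0,\delta,\beta,\delta_2,\delta_3$, with $\mathcal Y_N(j):=\tilde V_N^{-1}(j,[0,\theta_0])$ and $\mathcal P_N(j):=\tilde V_N^{-1}(j,[0,\delta(N)])$: (P1) for all $N\ge N_0$ the families $\mathcal Y_N(\cdot),\mathcal P_N(\cdot)$ are forward invariant and $\tilde V_N$ is a uniform time-varying Lyapunov function on $\mathcal Y_N(j)\setminus\mathcal P_N(j)$; (P2) for all $N\ge N_0$, $j_0,j\in\mathbb N_0$, $X_{j_0}\in\mathcal Y_N(j_0)$ with $X_{\mu_N}(j;j_0,X_{j_0})\notin\mathcal P_N(j_0+j)$: $d(X_{\mu_N}(j;j_0,X_{j_0}),X^s(j+j_0))\le\beta(d(X_{j_0},X^s(j_0)),j)$; (P3) for all sufficiently large $N,K\in\mathbb N$ and all $X_0\in\tilde V_N^{-1}(0,[0,\theta_0])$: $J^{cl}_K(X_0,\mu_N)\le\inf_{\mathbf U}J_K(0,X_0,\mathbf U)+\delta_2(N)+K\nu(N)+\delta_3(K)$, the infimum being over all $\mathbf U\in\mathbb U^K_{ad}(0,X_0)$ with $X_{\mathbf U}(K;0,X_0)\in\bar B^d_\kappa(X^s(K))$, $\kappa=\max\{\beta(d(X_0,X^s(0)),K),\alpha^{-1}(\delta(N))\}$.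
   Formalization: In the class KL, β(s,·) is required to lie in L only for s>0, since β(·,t) in K forces β(0,t)=0 and KL would otherwise be empty; ''monotone'' for γ_V is read as nonincreasing in N and nondecreasing in ρ. *)

(* Defs.v *)
From HB Require Import structures.
From mathcomp Require Import all_boot all_order all_algebra.
From mathcomp Require Import all_classical all_reals all_analysis.

Set Implicit Arguments.
Unset Strict Implicit.
Unset Printing Implicit Defensive.

Import Order.TTheory GRing.Theory Num.Theory.
Import numFieldNormedType.Exports.

Local Open Scope classical_set_scope.
Local Open Scope ring_scope.

Section comparison_functions.
Context {R : realType}.
Implicit Types (a : R -> R) (b : R -> R -> R).

Definition class_K a :=
  [/\ {within `[0, +oo[, continuous a},
      {in `[0, +oo[ &, {homo a : x y / x < y}} & a 0 = 0].

Definition class_Kinf a :=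
  class_K a /\ forall M : R, exists2 s : R, 0 <= s & M < a s.

(* Strict decrease and convergence to 0 force a > 0 on [0, +oo[. *)
Definition class_L a :=
  [/\ {within `[0, +oo[, continuous a},
      {in `[0, +oo[ &, {homo a : x y /~ x < y}} &
      a x @[x --> +oo%R] --> (0 : R)].

(* b s is required to be of class L for s > 0 only: class K in the first
   argument forces b 0 t = 0 for all t, so that b 0 is never of class L. *)
Definition class_KL b :=
  [/\ {within [set z : R * R | 0 <= z.1 /\ 0 <= z.2],
        continuous (fun z : R * R => b z.1 z.2)},
      (forall t, 0 <= t -> class_K (b ^~ t)) &
      (forall s, 0 < s -> class_L (b s))].

Definition inv_Kinf a : R -> R := 'pinv_(fun=> 0) `[0, +oo[ a.

End comparison_functions.

Definition separable_space (T : topologicalType) :=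
  exists2 D : set T, countable D & dense D.

Definition borel (T : topologicalType) : set (set T) := <<s @open T >>.
Arguments borel T : clear implicits.

Section random_variables.
Context {R : realType} {disp : measure_display} {Omega : measurableType disp}.
Variable P : probability Omega R.

Definition random_var (T : topologicalType) : set (Omega -> T) :=
  [set Y | forall B, borel T B -> measurable (Y @^-1` B)].

Definition sigma_of (T : topologicalType) (Y : Omega -> T) : set (set Omega) :=
  preimage_set_system [set: Omega] Y (borel T).

Definition same_law (T : topologicalType) (Y Z : Omega -> T) :=
  forall B, borel T B -> P (Y @^-1` B) = P (Z @^-1` B).

Definition independent (T T' : topologicalType)
    (Y : Omega -> T) (Z : Omega -> T') :=
  forall A B, borel T A -> borel T' B ->
    P (Y @^-1` A `&` Z @^-1` B) = (P (Y @^-1` A) * P (Z @^-1` B))%E.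

Definition mutually_independent (T : topologicalType) (Y : nat -> Omega -> T) :=
  forall (s : seq nat) (B : nat -> set T), uniq s -> (forall k, borel T (B k)) ->
    P (\bigcap_(k in [set` s]) (Y k @^-1` B k)) =
    (\prod_(k <- s) P (Y k @^-1` B k))%E.

Definition iid (T : topologicalType)
    (Y : nat -> Omega -> T) (Q : set T -> \bar R) :=
  [/\ (forall k, random_var (Y k)), mutually_independent Y &
      (forall k B, borel T B -> P (Y k @^-1` B) = Q B)].

Definition pseudometric_on (T : Type) (A : set T) (d : T -> T -> \bar R) :=
  [/\ (forall x y, A x -> A y -> (0 <= d x y)%E),
      (forall x, A x -> d x x = 0%E),
      (forall x y, A x -> A y -> d x y = d y x) &
      (forall x y z, A x -> A y -> A z -> (d x z <= d x y + d y z)%E)].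

End random_variables.
Arguments random_var {disp Omega} T.

Record control_problem (R : realType) (disp : measure_display)
    (Omega : measurableType disp) (P : probability Omega R)
    (XX UU WW : completeNormedModType R) := ControlProblem {
  dyn : XX * UU * WW -> XX ;
  cost : XX * UU -> R ;
  ctrl : set UU ;
  noise : nat -> Omega -> WW }.

Section optimal_control.
Context {R : realType} {disp : measure_display} {Omega : measurableType disp}.
Context {P : probability Omega R} {XX UU WW : completeNormedModType R}.
Variable S : control_problem P XX UU WW.
Implicit Types (X : Omega -> XX) (j k N K : nat).

Definition standing_assumptions
    (PW : probability (g_sigma_algebraType (@open WW)) R) :=
  [/\ [/\ separable_space XX, separable_space UU & separable_space WW],
      continuous (dyn S),
      lower_semicontinuous (fun z => (cost S z)%:E),
      (exists c : R, forall z, c <= cost S z) &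
      iid P (noise S) PW].

Definition ell X (U : Omega -> UU) : \bar R := 'E_P[fun w => cost S (X w, U w)].

Definition step j X (U : Omega -> UU) : Omega -> XX :=
  fun w => dyn S (X w, U w, noise S j w).

Fixpoint traj j X (U : nat -> Omega -> UU) k : Omega -> XX :=
  if k is k'.+1 then step (j + k') (traj j X U k') (U k') else X.

Definition adm X : set (Omega -> UU) :=
  [set U | [/\ random_var UU U, sigma_of U `<=` sigma_of X &
               forall w, ctrl S (U w)]].

Definition adm_seq N j X : set (nat -> Omega -> UU) :=
  [set U | forall k, (k < N)%N -> adm (traj j X U k) (U k)].

Definition adm_seq_inf j X : set (nat -> Omega -> UU) :=
  [set U | forall k, adm (traj j X U k) (U k)].

(* The random states that may occur at time j, under the standing convention
   that the noise acting at any time is independent of the state and the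
   control at that time.  All sets of, and quantifications over, states at
   time j are relative to [state j]. *)
Definition state j : set (Omega -> XX) :=
  [set X | random_var XX X /\
    forall U, adm_seq_inf j X U -> forall k,
      independent P (fun w => (traj j X U k w, U k w)) (noise S (j + k))].

Definition J N j X (U : nat -> Omega -> UU) : \bar R :=
  (\sum_(k < N) ell (traj j X U k) (U k))%E.

Definition V N j X : \bar R := ereal_inf [set J N j X U | U in adm_seq N j X].

Definition minimizer N j X (U : nat -> Omega -> UU) :=
  adm_seq N j X U /\ forall U', adm_seq N j X U' -> (J N j X U <= J N j X U')%E.

(* A horizon-N MPC feedback may depend on the time j, as the minimizers do. *)
Definition mpc_feedback (mu : nat -> nat -> (Omega -> XX) -> Omega -> UU) :=
  forall N j X, (0 < N)%N -> state j X ->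
    exists2 U, minimizer N j X U & mu N j X = U 0%N.

Section closed_loop.
Variable muN : nat -> (Omega -> XX) -> Omega -> UU.

Definition cl_step j X := step j X (muN j X).

Fixpoint cl_traj j X k : Omega -> XX :=
  if k is k'.+1 then cl_step (j + k') (cl_traj j X k') else X.

Definition Jcl K X : \bar R :=
  (\sum_(j < K) ell (cl_traj 0 X j) (muN j (cl_traj 0 X j)))%E.

Definition forward_invariant (Y : nat -> set (Omega -> XX)) :=
  forall j X, Y j X -> Y j.+1 (cl_step j X).

End closed_loop.

Definition stationary_pair (Xs : nat -> Omega -> XX) (Us : nat -> Omega -> UU) :=
  [/\ state 0 (Xs 0%N),
      (forall k, Xs k.+1 = step k (Xs k) (Us k)),
      adm_seq_inf 0 (Xs 0%N) Us &
      (forall k, [/\ same_law P (Xs k) (Xs 0%N), same_law P (Us k) (Us 0%N) &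
         same_law P (fun w => (Xs k w, Us k w)) (fun w => (Xs 0%N w, Us 0%N w))])].

Section at_stationary_pair.
Variables (Xs : nat -> Omega -> XX) (Us : nat -> Omega -> UU).

(* The stage cost depends on the joint law only, hence not on the time. *)
Definition ell_s : \bar R := ell (Xs 0%N) (Us 0%N).

(* Pseudometrics are extended-valued: [er_map a (d X Y)] is a (d X Y), with the
   convention a(+oo) = +oo. *)
Variable d : (Omega -> XX) -> (Omega -> XX) -> \bar R.

Definition cball (r : \bar R) j : set (Omega -> XX) :=
  [set X | state j X /\ (d X (Xs j) <= r)%E].

Definition lyapunov (muN : nat -> (Omega -> XX) -> Omega -> UU)
    (Y : nat -> set (Omega -> XX)) (L : nat -> (Omega -> XX) -> \bar R) :=
  (forall j X, Y j X -> (0 <= L j X < +oo)%E) /\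
  exists a1 a2 aV : R -> R,
    [/\ class_Kinf a1, class_Kinf a2, class_K aV &
      forall j X, Y j X -> Y j.+1 (cl_step muN j X) ->
        [/\ (er_map a1 (d X (Xs j)) <= L j X)%E,
            (L j X <= er_map a2 (d X (Xs j)))%E &
            (L j.+1 (cl_step muN j X) <= L j X - er_map aV (d X (Xs j)))%E]].

Definition cheaply_reachable (r CV : R) :=
  forall N j X, cball r%:E j X -> (V N j X - N%:R%:E * ell_s <= CV%:E)%E.

Section rotated.
Variable lam : nat -> (Omega -> XX) -> R.

Definition tell j X (U : Omega -> UU) : \bar R :=
  (ell X U - ell_s + (lam j X)%:E - (lam j.+1 (step j X U))%:E)%E.

Definition tJ N j X (U : nat -> Omega -> UU) : \bar R :=
  (\sum_(k < N) tell (j + k) (traj j X U k) (U k))%E.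

Definition tV N j X : \bar R :=
  ereal_inf [set tJ N j X U | U in adm_seq N j X].

Definition sublevel N (a : R) j : set (Omega -> XX) :=
  [set X | state j X /\ (0 <= tV N j X <= a%:E)%E].

Definition strictly_dissipative (alpha : R -> R) :=
  [/\ (exists c : R, forall j X, state j X -> c <= lam j X),
      class_Kinf alpha &
      forall j X U, state j X -> adm X U ->
        (er_map alpha (d X (Xs j)) <= tell j X U)%E].

End rotated.

Definition hell X (U : Omega -> UU) : \bar R := (ell X U - ell_s)%E.

Definition hJ N j X (U : nat -> Omega -> UU) : \bar R :=
  (\sum_(k < N) hell (traj j X U k) (U k))%E.

(* The infimum of the infinite-horizon costs: the cost of U is the limit of its
   partial sums, and sequences U for which it does not exist have no cost. *)
Definition hV_inf j X : \bar R :=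
  ereal_inf [set v | exists2 U, adm_seq_inf j X U &
                     hJ N j X U @[N --> \oo] --> v].

End at_stationary_pair.
End optimal_control.

(* Main.v *)
Require Import Defs.
From HB Require Import structures.
From mathcomp Require Import all_boot all_order all_algebra.
From mathcomp Require Import all_classical all_reals all_analysis.
From mathcomp Require Import ring lra zify.

Set Implicit Arguments.
Unset Strict Implicit.
Unset Printing Implicit Defensive.

Import Order.TTheory GRing.Theory Num.Theory.
Import numFieldNormedType.Exports.

Local Open Scope classical_set_scope.
Local Open Scope ring_scope.

(** The rotated stage cost [tell] dominates [alpha] of the distance to the
    stationary process, and along every trajectory the original and the
    rotated costs differ only by the stationary cost and by the storage
    function at the two ends ([J_tJ]). The rotated value [tV] therefore
    vanishes at the stationary process, lies between [alpha] and [gtV] of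
    the distance near it, and is the candidate Lyapunov function. The
    feedback, however, minimizes the original cost, so that [tV] decreases
    along the closed loop only up to an error.

    Bounding this error is the heart of the matter
    ([rotated_value_decrease]). A minimizer of the original problem and an
    almost-minimizer of the rotated one both have rotated cost at most
    [Clam + Claml + CV]. So both are within [theta (N / 12)] of the
    stationary process at some common time [p] with [0 < p <= N / 2]
    ([common_small_term]). Cutting both at [p] and exchanging the tails,
    whose original values and initial storage values almost agree, shows
    that the minimizer is almost optimal for the rotated problem up to time
    [p]; beyond [p] the rotated value is small. The resulting error,
    [decrease_error N], is at most [nu N] and tends to zero.

    What remains is a practical stability argument. Let [decay] be [alpha]
    after the inverse of [gtV]; the value [w] of a state then satisfies
    [w+ <= w - decay w + decrease_error N]. Where [w] exceeds [delta N], the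
    error is at most half of the decrease; where it does not, [w+] is at
    most [delta N] again. As long as the closed loop stays off that target,
    [w] is decreasing, so that [k * decay w_k / 2 <= w_0], and the bound
    [beta] of class KL can be read off from this inequality
    ([class_KL_inv_quotient], [attraction]).

    Summing up the decrease bounds the closed-loop cost from above
    ([Jcl_le]). Conversely, a competitor that ends close to the stationary
    process can be prolonged at small rotated cost, so its rotated cost
    cannot be much smaller than [tV] ([J_ge_near]). Up to the accumulated
    error, the two bounds differ by [loss] of a common bound on the final
    distances, which splits into [delta2] and [delta3]. On the infinite
    horizon, the rotated cost of a competitor is either unbounded, and then
    its original cost exceeds that of the closed loop by any amount, or
    bounded, and then its distance to the stationary process tends to zero
    ([overtaking_near_optimal]). *)

(** * Comparison functions *)

Section comparison_theory.
Context {R : realType}.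

Lemma within_distP (T : pseudoMetricType R) (A : set T) (f : T -> R) :
  {within A, continuous f} <->
  forall x, A x -> forall e, 0 < e ->
    exists2 del : R, 0 < del &
      forall y, A y -> ball x del y -> `|f x - f y| < e.
Proof.
split=> [/subspace_continuousP cf x Ax e e0|cf].
  have /cvgrPdist_lt/(_ e e0) := cf x Ax.
  rewrite near_withinE => /nbhs_ballP[del /= del0 H].
  by exists del => // y Ay xy; apply: H.
apply/subspace_continuousP => x Ax; apply/cvgrPdist_lt => e e0.
rewrite near_withinE; have [del del0 H] := cf x Ax e e0.
by apply/nbhs_ballP; exists del => //= y xy Ay; apply: H.
Qed.

Lemma within_comp (T : pseudoMetricType R) (A : set T) (B : set R)
    (f : T -> R) (g : R -> R) :
  (forall x, A x -> B (f x)) ->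
  {within A, continuous f} -> {within B, continuous g} ->
  {within A, continuous (g \o f)}.
Proof.
move=> AB /within_distP cf /within_distP cg; apply/within_distP => x Ax e e0.
have [d1 d10 H1] := cg (f x) (AB x Ax) e e0.
have [d2 d20 H2] := cf x Ax d1 d10.
by exists d2 => // y Ay xy; apply: H1; [exact: AB|exact: H2].
Qed.

Implicit Types (a b l : R -> R) (x y e : R).

Lemma class_K_lt a x y : class_K a -> 0 <= x -> x < y -> a x < a y.
Proof.
move=> [_ ia _] x0 xy; apply: ia => //; rewrite in_itv/= andbT//.
exact: le_trans (ltW xy).
Qed.

Lemma class_K_le a x y : class_K a -> 0 <= x -> x <= y -> a x <= a y.
Proof.
by move=> Ka x0; rewrite le_eqVlt => /predU1P[->//|/(class_K_lt Ka x0)/ltW].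
Qed.

Lemma class_K_ge0 a x : class_K a -> 0 <= x -> 0 <= a x.
Proof. by move=> Ka x0; case: (Ka) => _ _ <-; apply: class_K_le. Qed.

Lemma class_K_gt0 a x : class_K a -> 0 < x -> 0 < a x.
Proof. by move=> Ka x0; case: (Ka) => _ _ <-; apply: class_K_lt. Qed.

Lemma class_K_leP a x y : class_K a -> 0 <= x -> 0 <= y ->
  (a x <= a y) = (x <= y).
Proof.
move=> Ka x0 y0; apply/idP/idP; last exact: class_K_le.
by apply: contraTT; rewrite -!ltNge => /(class_K_lt Ka y0).
Qed.

Lemma class_K_inj a x y : class_K a -> 0 <= x -> 0 <= y -> a x = a y -> x = y.
Proof.
move=> Ka x0 y0 E; apply/le_anti.
by rewrite -(class_K_leP Ka x0 y0) -(class_K_leP Ka y0 x0) E lexx.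
Qed.

Lemma class_K_small a e : class_K a -> 0 < e ->
  exists2 t, 0 < t & forall x, 0 <= x <= t -> a x <= e.
Proof.
move=> Ka e0; case: (Ka) => /within_distP + _ a0.
move=> /(_ 0); rewrite /= in_itv/= lexx => /(_ isT e e0)[t t0 H].
exists (t / 2); first by rewrite divr_gt0.
move=> x /andP[x0 xt]; have := H x; rewrite a0 sub0r normrN.
rewrite in_itv/= andbT -ball_normE/= sub0r normrN ger0_norm// => /(_ x0).
by move=> /(_ ltac:(lra))/ltW; apply: le_trans; exact: ler_norm.
Qed.

Lemma class_K_comp a b : class_K a -> class_K b -> class_K (a \o b).
Proof.
move=> Ka Kb; case: (Ka) (Kb) => ca _ a0 [cb _ b0]; split=> /=.
- apply: within_comp cb ca => x; rewrite /= !in_itv/= !andbT.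
  exact: class_K_ge0.
- move=> x y; rewrite !in_itv/= !andbT => x0 y0 xy.
  by apply: class_K_lt => //; [exact: class_K_ge0|exact: class_K_lt].
- by rewrite b0 a0.
Qed.

Lemma class_K_add a b : class_K a -> class_K b -> class_K (a \+ b).
Proof.
move=> Ka Kb; case: (Ka) (Kb) => ca _ a0 [cb _ b0]; split=> /=.
- by move=> x; apply: within_continuousD.
- move=> x y; rewrite !in_itv/= !andbT => x0 y0 xy.
  by apply: ltrD; exact: class_K_lt.
- by rewrite b0 a0 addr0.
Qed.

Lemma class_K_scale c a : 0 < c -> class_K a -> class_K (fun x => c * a x).
Proof.
move=> c0 Ka; case: (Ka) => ca _ a0; split=> /=.
- have cc : {within [set: R], continuous (fun x => c * x)}.
    apply: continuous_subspaceT => x.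
    by apply: cvgM; [exact: cvg_cst|exact: cvg_id].
  by apply: within_comp ca cc.
- move=> x y; rewrite !in_itv/= !andbT => x0 y0 xy.
  by rewrite ltr_pM2l//; exact: class_K_lt.
- by rewrite a0 mulr0.
Qed.

Lemma class_Kinf_comp a b : class_Kinf a -> class_Kinf b -> class_Kinf (a \o b).
Proof.
move=> [Ka ua] [Kb ub]; split; first exact: class_K_comp.
move=> M; have [s s0 Ms] := ua M; have [t t0 st] := ub s.
by exists t => //=; apply: (lt_trans Ms); exact: class_K_lt.
Qed.

Lemma class_Kinf_scale c a :
  0 < c -> class_Kinf a -> class_Kinf (fun x => c * a x).
Proof.
move=> c0 [Ka ua]; split; first exact: class_K_scale.
move=> M; have [s s0 Ms] := ua (M / c); exists s => //.
by rewrite mulrC -ltr_pdivrMr.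
Qed.

Lemma class_Kinf_surj a y : class_Kinf a -> 0 <= y -> exists2 x, 0 <= x & a x = y.
Proof.
move=> [Ka ua] y0; have [s s0 ys] := ua y; case: (Ka) => ca _ a0.
have [x] : exists2 c, c \in `[0, s] & a c = y.
  apply: IVT => //.
    by apply: continuous_subspaceW ca => x /=; rewrite !in_itv/= andbT => /andP[].
  by rewrite a0 ge_min y0/= le_max (ltW ys) orbT.
by rewrite in_itv/= => /andP[x0 _] <-; exists x.
Qed.

(** A jump of a monotone function would leave a gap in its range. *)
Lemma surjective_class_K a :
  (forall x y, 0 <= x -> x < y -> a x < a y) -> a 0 = 0 ->
  (forall y, 0 <= y -> exists2 x, 0 <= x & a x = y) -> class_K a.
Proof.
move=> ia a0 sa.
have lea x y : 0 <= x -> x <= y -> a x <= a y.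
  by move=> x0; rewrite le_eqVlt => /predU1P[->//|/(ia _ _ x0)/ltW].
have rlt x y : 0 <= x -> 0 <= y -> a x < a y -> x < y.
  by move=> x0 y0; apply: contraTT; rewrite -!leNgt; exact: lea.
have ge0 x : 0 <= x -> 0 <= a x by move=> x0; rewrite -a0; exact: lea.
split=> //; last by move=> x y; rewrite !in_itv/= !andbT => x0 _; exact: ia.
apply/within_distP => x; rewrite /= in_itv/= andbT => x0 e e0.
have ax0 := ge0 _ x0.
have [x1 x10 ax1] := sa (a x + e / 2) ltac:(lra).
have xx1 : x < x1 by apply: rlt => //; lra.
have [ae|ae] := ltP (a x) (e / 2).
  exists (x1 - x); first lra.
  move=> y; rewrite /= in_itv/= andbT => y0.
  rewrite -ball_normE/= ltr_norml => /andP[h1 h2].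
  have /ia : y < x1 by lra.
  by have := ge0 _ y0; rewrite ltr_norml => ? /(_ y0) ?; apply/andP; split; lra.
have [x2 x20 ax2] := sa (a x - e / 2) ltac:(lra).
have xx2 : x2 < x by apply: rlt => //; lra.
exists (Num.min (x1 - x) (x - x2)); first by rewrite lt_min; apply/andP; split; lra.
move=> y; rewrite /= in_itv/= andbT => y0.
rewrite -ball_normE/= ltr_norml lt_min ltrNl lt_min.
move=> /andP[/andP[h1 h2] /andP[h3 h4]].
have := ia y x1 y0 ltac:(lra); have := ia x2 y x20 ltac:(lra).
by rewrite ltr_norml => ? ?; apply/andP; split; lra.
Qed.

Section inverse.
Variable a : R -> R.
Hypothesis Ka : class_Kinf a.

Let aK : class_K a. Proof. by case: Ka. Qed.

Let inj_a : {in [set` `[0, +oo[] &, injective a}.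
Proof.
by move=> x y; rewrite !inE/= !in_itv/= !andbT => x0 y0; exact: class_K_inj.
Qed.

Lemma inv_KinfK x : 0 <= x -> inv_Kinf a (a x) = x.
Proof. by move=> x0; apply: pinvKV => //; rewrite inE/= in_itv/= x0. Qed.

Lemma inv_Kinf_ge0 y : 0 <= y -> 0 <= inv_Kinf a y.
Proof.
by move=> y0; have [x x0 <-] := class_Kinf_surj Ka y0; rewrite inv_KinfK.
Qed.

Lemma Kinf_invK y : 0 <= y -> a (inv_Kinf a y) = y.
Proof.
by move=> y0; have [x x0 <-] := class_Kinf_surj Ka y0; rewrite inv_KinfK.
Qed.

Lemma class_Kinf_inv : class_Kinf (inv_Kinf a).
Proof.
split.
  apply: surjective_class_K.
  - move=> x y x0 xy; have y0 : 0 <= y by exact: le_trans (ltW xy).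
    rewrite ltNge -(class_K_leP aK (inv_Kinf_ge0 y0) (inv_Kinf_ge0 x0)) !Kinf_invK//.
    by rewrite -ltNge.
  - by case: aK => _ _ {1}<-; rewrite inv_KinfK.
  - by move=> y y0; exists (a y); [exact: class_K_ge0|exact: inv_KinfK].
move=> M; exists (a (Num.max M 0 + 1)).
  by apply: class_K_ge0 => //; rewrite addr_ge0// le_max lexx orbT.
rewrite inv_KinfK ?addr_ge0// ?le_max ?lexx ?orbT//.
by rewrite ltr_pwDr// le_max lexx.
Qed.

End inverse.

Lemma er_map_le a (x : \bar R) y : class_K a ->
  (0 <= x)%E -> (x <= y%:E)%E -> (er_map a x <= (a y)%:E)%E.
Proof. by case: x => //= x Ka; rewrite !lee_fin; exact: class_K_le. Qed.

Lemma er_map_ge0 a (x : \bar R) : class_K a -> (0 <= x)%E -> (0 <= er_map a x)%E.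
Proof. by case: x => //= x Ka; rewrite !lee_fin; exact: class_K_ge0. Qed.

Lemma er_map_le_inv a (x : \bar R) y : class_Kinf a -> (0 <= x)%E -> 0 <= y ->
  (er_map a x <= y%:E)%E -> (x <= (inv_Kinf a y)%:E)%E.
Proof.
case: x => //= x Ka; rewrite !lee_fin => x0 y0 axy.
rewrite -(inv_KinfK Ka x0); have [Kia _] := class_Kinf_inv Ka.
by apply: class_K_le => //; apply: class_K_ge0 => //; case: Ka.
Qed.

Lemma class_L_lt l x y : class_L l -> 0 <= x -> x < y -> l y < l x.
Proof.
move=> [_ il _] x0 xy; apply: il => //; rewrite in_itv/= andbT//.
exact: le_trans (ltW xy).
Qed.

Lemma class_L_lim l e : class_L l -> 0 < e ->
  exists M : R, forall x, M <= x -> `|l x| < e.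
Proof.
move=> [_ _ /cvgrPdist_lt/(_ e) H] /H [M [_ HM]]; exists (M + 1) => x Mx.
by rewrite -normrN -sub0r; apply: HM; lra.
Qed.

Lemma class_L_gt0 l x : class_L l -> 0 <= x -> 0 < l x.
Proof.
move=> Ll x0; rewrite ltNge; apply/negP => lx.
have lx1 : l (x + 1) < 0.
  by apply: lt_le_trans lx; apply: (class_L_lt Ll) => //; lra.
have [M HM] := class_L_lim Ll (e := - l (x + 1)) ltac:(lra).
have y1 := lexx (Num.max M (x + 2)); rewrite {1}ge_max in y1.
case/andP: y1 => /HM + y2.
have := class_L_lt Ll (x := x + 1) ltac:(lra) (lt_le_trans _ y2).
rewrite ltr_norml => /(_ ltac:(lra)) ? /andP[? ?]; lra.
Qed.

Lemma class_L_nat_lim l e : class_L l -> 0 < e ->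
  exists M : nat, forall n, (M <= n)%N -> l n%:R <= e.
Proof.
move=> Ll /(class_L_lim Ll)[M HM]; exists (Num.bound `|M|) => n Mn.
apply: ltW; apply: le_lt_trans (ler_norm _) (HM _ _).
apply: le_trans (ler_norm _) _; apply: ltW.
by apply: lt_le_trans (archi_boundP _) _ => //; rewrite ler_nat.
Qed.

Lemma class_L_comp a l : class_K a -> class_L l -> class_L (a \o l).
Proof.
move=> Ka Ll; case: (Ka) (Ll) => ca _ a0 [cl _ ll]; split=> /=.
- apply: within_comp cl ca => x; rewrite /= !in_itv/= !andbT.
  by move=> x0; exact/ltW/class_L_gt0.
- move=> x y; rewrite !in_itv/= !andbT => x0 y0 xy.
  by apply: class_K_lt => //; [exact/ltW/class_L_gt0|exact: class_L_lt].
- apply/cvgrPdist_lt => e e0; have /within_distP := ca.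
  move=> /(_ 0); rewrite /= in_itv/= lexx => /(_ isT e e0)[del del0 H].
  have [M HM] := class_L_lim Ll del0.
  near=> x; rewrite -a0; have x0 : 0 <= x by near: x; exact: nbhs_pinfty_ge.
  apply: H.
    by rewrite /= in_itv/= andbT; exact/ltW/class_L_gt0.
  rewrite -ball_normE/= sub0r normrN; apply: HM.
  by near: x; apply: nbhs_pinfty_ge; rewrite num_real.
Unshelve. all: by end_near.
Qed.

(** The upper envelope of the ramps that equal [`|u n|] up to [n] and descend
    linearly to zero between [n] and [n + 1] passes above all points [(n, u n)], is
    Lipschitz, and at [x] only sees the terms with [n > x - 1]; the summand
    [1 / (x + 1)] makes it strictly decreasing. *)
Lemma class_L_majorant (u : nat -> R) :
  u @ \oo --> (0 : R) -> exists2 l, class_L l & forall n, u n <= l n%:R.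
Proof.
move=> u0; have [B [_ HB]] := cvg_seq_bounded (cvgP _ u0).
pose A := `|B| + 1; have A0 : 0 < A by rewrite /A ltr_wpDl.
have uA n : `|u n| <= A.
  by apply: HB => //; rewrite /A; have := ler_norm B; lra.
pose clip (t : R) := if t <= 0 then 0 else if 1 <= t then 1 else t.
have clip_lip s t : s <= t -> clip s <= clip t <= clip s + (t - s).
  rewrite /clip => st; case: (leP s 0); case: (leP 1 s); case: (leP t 0);
    case: (leP 1 t) => *; apply/andP; split; lra.
have clip01 t : 0 <= clip t <= 1.
  by rewrite /clip; case: (leP t 0); case: (leP 1 t) => *; apply/andP; split; lra.
pose ramp n x := `|u n| * clip (n%:R + 1 - x).
have ramp_ge0 n x : 0 <= ramp n x.
  by rewrite mulr_ge0//; case/andP: (clip01 (n%:R + 1 - x)).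
have ramp_leu n x : ramp n x <= `|u n|.
  by rewrite ler_piMr//; case/andP: (clip01 (n%:R + 1 - x)).
have ramp_lip n x y : x <= y -> ramp n y <= ramp n x <= ramp n y + A * (y - x).
  move=> xy; have /andP[] := clip_lip (n%:R + 1 - y) (n%:R + 1 - x) ltac:(lra).
  move=> /(ler_wpM2l (normr_ge0 (u n))) h /(ler_wpM2l (normr_ge0 (u n))).
  rewrite mulrDr => h'; apply/andP; split=> //; apply: le_trans h' _.
  by rewrite lerD2l; have := uA n; nra.
pose E x := [set ramp n x | n in [set: nat]].
pose psi x := sup (E x).
have hsE x : has_sup (E x).
  split; first by exists (ramp 0%N x); exists 0%N.
  by exists A => _ [n _ <-]; apply: le_trans (ramp_leu n x) (uA n).
have psi_ub n x : ramp n x <= psi x by apply: ub_le_sup; [case: (hsE x)|exists n].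
have psi_le x c : (forall n, ramp n x <= c) -> psi x <= c.
  by move=> H; apply: ge_sup; [case: (hsE x)|move=> _ [n _ <-]].
have psi_lip x y : x <= y -> psi y <= psi x <= psi y + A * (y - x).
  move=> xy; apply/andP; split; apply: psi_le => n.
    by apply: le_trans (psi_ub n x); case/andP: (ramp_lip n x y xy).
  case/andP: (ramp_lip n x y xy) => _ /le_trans; apply.
  by rewrite lerD2r.
have psi_ge0 x : 0 <= psi x by apply: le_trans (psi_ub 0%N x).
have cpsi : continuous psi.
  move=> x; apply/cvgrPdist_lt => e e0; apply/nbhs_ballP.
  exists (e / A) => /=; first by rewrite divr_gt0.
  move=> y /=; rewrite ltr_pdivlMr// => h.
  have [xy|/ltW xy] := leP x y.
    have /andP[h1 h2] := psi_lip _ _ xy.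
    rewrite ger0_norm ?subr_ge0//; move: h; rewrite ler0_norm ?subr_le0//.
    by nra.
  have /andP[h1 h2] := psi_lip _ _ xy.
  rewrite ler0_norm ?subr_le0//; move: h; rewrite ger0_norm ?subr_ge0//.
  by nra.
pose q (x : R) := (`|x| + 1)^-1.
have q_pos x : 0 < q x by rewrite invr_gt0 ltr_wpDl.
exists (psi \+ q); last first.
  move=> n /=; apply: le_trans (ler_norm _) _.
  apply: (@le_trans _ _ (ramp n n%:R)); last by rewrite ler_wpDr ?psi_ub// ltW.
  by rewrite /ramp /clip addrAC subrr add0r lexx ifN ?mulr1// -ltNge ltr01.
split.
- apply: continuous_subspaceT => x; apply: cvgD; first exact: cpsi.
  apply: cvgV; first by rewrite gt_eqF// ltr_wpDl.
  by apply: cvgD; [exact: norm_continuous|exact: cvg_cst].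
- move=> x y; rewrite !in_itv/= !andbT => x0 y0 xy.
  apply: ler_ltD; first by case/andP: (psi_lip _ _ (ltW xy)).
  by rewrite /q !ger0_norm// ltf_pV2 ?posrE; lra.
- apply/cvgrPdist_lt => e e0.
  move/cvgrPdist_lt: u0 => /(_ (e / 2)); case; first lra.
  move=> M _ HM; near=> x.
  have xM : M%:R + 1 <= x.
    by near: x; apply: nbhs_pinfty_ge; rewrite num_real.
  have xe : 2 / e + 1 <= x.
    by near: x; apply: nbhs_pinfty_ge; rewrite num_real.
  rewrite sub0r normrN /= ger0_norm; last by rewrite addr_ge0// ltW.
  have : psi x <= e / 2.
    apply: psi_le => n; have [nM|Mn] := ltnP n M.
      have : n.+1%:R <= (M%:R : R) by rewrite ler_nat.
      rewrite /ramp /clip -natr1 => ?; rewrite ifT; last lra.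
      by rewrite mulr0; lra.
    apply: le_trans (ramp_leu n x) _; apply: ltW.
    by have := HM n Mn; rewrite /= sub0r normrN.
  suff : q x < e / 2 by lra.
  have x0 := ler_norm x; have x1 : 0 < `|x| + 1 by rewrite ltr_wpDl.
  rewrite /q -ltf_pV2 ?posrE ?invr_gt0//; last lra.
  by rewrite invrK invf_div; lra.
Unshelve. all: by end_near.
Qed.

(** The quotient [g s / (1 + t)] is of class K in [s] and, for [s > 0], of class
    L in [t]; both properties survive composition with a function of class K. *)
Lemma class_KL_inv_quotient (z g : R -> R) : class_Kinf z -> class_Kinf g ->
  class_KL (fun s t => inv_Kinf z (g s / (1 + t))).
Proof.
move=> Kz [Kg _]; have [Ki _] := class_Kinf_inv Kz.
have cg := let: And3 c _ _ := Kg in c.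
have ci := let: And3 c _ _ := Ki in c.
split.
- apply: (@within_comp _ _ [set` `[0, +oo[] (fun z : R * R => g z.1 / (1 + z.2))
      (inv_Kinf z) _ _ ci).
    move=> [s t] /= [s0 t0]; rewrite in_itv/= andbT divr_ge0//; last lra.
    exact: class_K_ge0.
  have c1 : {within [set z : R * R | 0 <= z.1 /\ 0 <= z.2],
               continuous (fun z : R * R => g z.1)}.
    apply: (@within_comp _ _ [set` `[0, +oo[] (@fst R R) g _ _ cg).
      by move=> [s t] /= [s0 _]; rewrite in_itv/= s0.
    by apply: continuous_subspaceT => x; exact: cvg_fst.
  apply/subspace_continuousP => -[s t] /= st0.
  apply: cvgM; first by move/subspace_continuousP: c1; exact.
  apply: cvgV; first by rewrite gt_eqF//; case: st0 => _ /= t0; lra.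
  apply: cvgD; first exact: cvg_cst.
  have /subspace_continuousP/(_ (s, t) st0) : {within
      [set z : R * R | 0 <= z.1 /\ 0 <= z.2], continuous (@snd R R)}.
    by apply: continuous_subspaceT => x; exact: cvg_snd.
  exact.
- move=> t t0; apply: (@class_K_comp _ (fun s => g s / (1 + t))) => //.
  under eq_fun do rewrite mulrC.
  by apply: class_K_scale => //; rewrite invr_gt0; lra.
- move=> s s0; apply: (@class_L_comp _ (fun t => g s / (1 + t))) => //.
  have gs0 : 0 < g s by exact: class_K_gt0.
  split.
  + apply/subspace_continuousP => t /=; rewrite in_itv/= andbT => t0.
    apply: cvgM; first exact: cvg_cst.
    apply: cvgV; first by rewrite gt_eqF//; lra.
    by apply: cvgD; [exact: cvg_cst|exact: cvg_within].
  + move=> x y; rewrite !in_itv/= !andbT => x0 y0 xy.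
    by rewrite ltr_pM2l// ltf_pV2 ?posrE; lra.
  + apply/cvgrPdist_lt => e e0; near=> t.
    have t0 : 0 < t by near: t; apply: nbhs_pinfty_gt; rewrite num_real.
    have te : g s / e < t.
      by near: t; apply: nbhs_pinfty_gt; rewrite num_real.
    have d0 : 0 <= g s / (1 + t) by rewrite divr_ge0 ?ltW//; lra.
    rewrite sub0r normrN ger0_norm//.
    rewrite ltr_pdivrMr; last lra.
    by move: te; rewrite ltr_pdivrMr// => ?; nra.
Unshelve. all: by end_near.
Qed.

Lemma limn_einf_ge0 (u : nat -> \bar R) :
  (forall e, 0 < e -> exists n, forall k, (n <= k)%N -> ((- e)%:E <= u k)%E) ->
  (0 <= limn_einf u)%E.
Proof.
move=> H; apply/lee_subgt0Pr => e /H[n Hn]; rewrite sub0e limn_einf_lim.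
apply: lime_ge; first exact: is_cvg_einfs.
exists n => // k /= nk; apply: le_ereal_inf_tmp => _ [i /= ki <-].
by apply: Hn; exact: leq_trans ki.
Qed.

(** A convergent series has terms tending to zero. *)
Lemma bounded_sum_small (x : nat -> \bar R) (B e : R) :
  (forall k, 0 <= x k)%E -> (forall n, \sum_(k < n) x k <= B%:E)%E ->
  0 < e -> exists n, forall k, (n <= k)%N -> (x k <= e%:E)%E.
Proof.
move=> x0 xB e0.
have fx k : x k \is a fin_num.
  rewrite ge0_fin_numE//; apply: le_lt_trans (ltry B).
  apply: le_trans (xB k.+1); rewrite big_ord_recr/= leeDr//.
  by apply: sume_ge0.
have /cvgrPdist_lt/(_ e e0)[n _ Hn] : (fine \o x) @ \oo --> (0 : R).
  apply: cvg_series_cvg_0; apply: nondecreasing_is_cvgn.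
    apply/nondecreasing_seqP => n; rewrite seriesSr/= lerDl.
    exact: fine_ge0.
  exists B => _ [n _ <-]; rewrite /series/= -lee_fin -sumEFin big_mkord.
  by under eq_bigr do rewrite fineK//; exact: xB.
exists n => k /Hn; rewrite /= sub0r normrN => /ltW.
rewrite -(fineK (fx k)) lee_fin; apply: le_trans; exact: ler_norm.
Qed.

End comparison_theory.
(** * Measurability of the controlled states *)

Section measurability.
Context {R : realType} {disp : measure_display} {Omega : measurableType disp}.

Lemma random_var_open (T : topologicalType) (Y : Omega -> T) :
  (forall O, open O -> measurable (Y @^-1` O)) -> random_var T Y.
Proof.
move=> mY.
have sY := @sigma_algebra_image _ _ setT Y _ (@sigma_algebra_measurable _ Omega).
move=> B bB; rewrite -[_ @^-1` _]setTI; move: B bB; apply: smallest_sub => // O.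
by move=> /mY; rewrite /image_set_system/= setTI.
Qed.

Lemma measurable_bigcup_countable (I : Type) (D : set I) (F : I -> set Omega) :
  countable D -> (forall i, D i -> measurable (F i)) ->
  measurable (\bigcup_(i in D) F i).
Proof.
move=> /pfcard_geP[->|[f]] mF; first by rewrite bigcup_set0.
rewrite -(image_eq f) bigcup_image; apply: bigcup_measurable => k _.
by apply: mF; exact: funS.
Qed.

Lemma separable_second_countable (T : pseudoMetricNormedZmodType R) :
  separable_space T -> @second_countable T.
Proof.
move=> [D cD dD].
exists [set ball xn.1 (xn.2.+1%:R^-1 : R) | xn in D `*` [set: nat]].
  by apply: sub_countable (card_image_le _ _) _; exact: countableX.
split=> [_ [xn _ <-]|x]; first exact: ball_open.
move=> O /= /nbhs_ballP[e /= e0 xO].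
have [n ne] : exists n : nat, n.+1%:R^-1 < e / 2 :> R.
  have e2 : 0 <= 2 / e by rewrite divr_ge0// ltW.
  exists (Num.bound (2 / e)); rewrite invf_plt ?posrE//; last lra.
  rewrite invf_div; apply: lt_trans (archi_boundP e2) _.
  by rewrite ltr_nat.
have xn : ball x (n.+1%:R^-1 : R) x by apply: ballxx; rewrite invr_gt0.
have [z [xz Dz]] := dD _ (ex_intro _ x xn) (ball_open _ _).
exists (ball z (n.+1%:R^-1 : R)).
  by split; [exists (z, n)|exact: ball_sym].
move=> y zy; apply: xO; apply: le_ball (ball_triangle xz zy).
by rewrite [e]splitr; apply/ltW/ltrD.
Qed.

Lemma second_countable_prod (T1 T2 : topologicalType) :
  @second_countable T1 -> @second_countable T2 ->
  @second_countable (T1 * T2)%type.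
Proof.
move=> [B1 cB1 [oB1 bB1]] [B2 cB2 [oB2 bB2]].
exists [set b.1 `*` b.2 | b in B1 `*` B2].
  by apply: sub_countable (card_image_le _ _) _; exact: countableX.
split=> [_ [[b1 b2] [/= /oB1 o1 /oB2 o2] <-]|[x y] O /= [[P Q] [/= Px Qy] PQ]].
  rewrite openE => -[u v] [/= ub1 vb2]; exists (b1, b2) => //.
  by split; exact: open_nbhs_nbhs.
have [b1 [B1b b1x] b1P] := bB1 x P Px; have [b2 [B2b b2y] b2Q] := bB2 y Q Qy.
exists (b1 `*` b2); first by split; [exists (b1, b2)|].
by move=> [u v] [/= /b1P ? /b2Q ?]; apply: PQ.
Qed.

(** An open subset of the product is a countable union of boxes, so its preimage
    is a countable union of measurable rectangles. *)
Lemma random_var_pair (T1 T2 : topologicalType)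
    (X : Omega -> T1) (Y : Omega -> T2) :
  @second_countable T1 -> @second_countable T2 ->
  random_var T1 X -> random_var T2 Y ->
  random_var (T1 * T2)%type (fun w => (X w, Y w)).
Proof.
move=> [B1 cB1 [oB1 bB1]] [B2 cB2 [oB2 bB2]] rX rY.
apply: random_var_open => O oO.
pose D := [set b | (B1 `*` B2) b /\ b.1 `*` b.2 `<=` O].
rewrite (_ : _ @^-1` O = \bigcup_(b in D) (X @^-1` b.1 `&` Y @^-1` b.2)); last first.
  apply/seteqP; split=> [w Ow|w [b [_ bO] [bX bY]]]; last exact: bO.
  have : nbhs (X w, Y w) O by exact: open_nbhs_nbhs.
  move=> [[P Q] [/= /bB1[b1 [B1b b1X] b1P] /bB2[b2 [B2b b2Y] b2Q]] PQ].
  exists (b1, b2) => //; split=> //= -[u v] [/= /b1P ? /b2Q ?]; exact: PQ.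
apply: measurable_bigcup_countable.
  by apply: sub_countable (subset_card_le _) (countableX cB1 cB2) => b [].
move=> [b1 b2] [[/= /oB1 o1 /oB2 o2] _].
by apply: measurableI; [apply: rX|apply: rY]; exact: sub_sigma_algebra.
Qed.

Lemma random_var_continuous (T1 T2 : topologicalType) (f : T1 -> T2)
    (X : Omega -> T1) :
  continuous f -> random_var T1 X -> random_var T2 (f \o X).
Proof.
move=> /continuousP cf rX; apply: random_var_open => O oO.
by rewrite comp_preimage; apply: rX; apply: sub_sigma_algebra; exact: cf.
Qed.

End measurability.

(** * Trajectories and dynamic programming *)

Section trajectories.
Context {R : realType} {disp : measure_display} {Omega : measurableType disp}.
Context {P : probability Omega R} {XX UU WW : completeNormedModType R}.
Variable S : control_problem P XX UU WW.
Implicit Types (X : Omega -> XX) (U : nat -> Omega -> UU) (j k n m N : nat).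

Definition splice n U U' : nat -> Omega -> UU :=
  fun k => if (k < n)%N then U k else U' (k - n)%N.

Lemma traj_shift j X U n k :
  traj S j X U (n + k) =
  traj S (j + n) (traj S j X U n) (fun i => U (n + i)%N) k.
Proof. by elim: k => [|k IH]; rewrite ?addn0// addnS/= IH addnA. Qed.

Lemma eq_traj j X U U' k : (forall i, (i < k)%N -> U i = U' i) ->
  traj S j X U k = traj S j X U' k.
Proof.
elim: k => //= k IH H; rewrite H// IH// => i ik; apply: H.
exact: leq_trans ik _.
Qed.

Lemma splice_shift n U U' : (fun i => splice n U U' (n + i)%N) = U'.
Proof. by apply/funext => i; rewrite /splice ltnNge leq_addr/= addKn. Qed.

Lemma traj_splicel j X U U' n k : (k <= n)%N ->
  traj S j X (splice n U U') k = traj S j X U k.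
Proof.
by move=> kn; apply: eq_traj => i ik; rewrite /splice (leq_trans ik kn).
Qed.

Lemma traj_splicer j X U U' n k :
  traj S j X (splice n U U') (n + k) =
  traj S (j + n) (traj S j X U n) U' k.
Proof. by rewrite traj_shift splice_shift traj_splicel. Qed.

Lemma adm_seqW n m j X U : (n <= m)%N ->
  adm_seq S m j X U -> adm_seq S n j X U.
Proof. by move=> nm H k kn; apply: H; exact: leq_trans nm. Qed.

Lemma adm_seq_shift n m j X U : adm_seq S (n + m) j X U ->
  adm_seq S m (j + n) (traj S j X U n) (fun i => U (n + i)%N).
Proof. by move=> H k km; rewrite -traj_shift; apply: H; rewrite ltn_add2l. Qed.

Lemma adm_seq_splice n m j X U U' : adm_seq S n j X U ->
  adm_seq S m (j + n) (traj S j X U n) U' ->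
  adm_seq S (n + m) j X (splice n U U').
Proof.
move=> aU aU' k km; rewrite {2}/splice; case: ltnP => kn.
  by rewrite traj_splicel; [exact: aU|exact: ltnW].
rewrite -{1}(subnKC kn) traj_splicer; apply: aU'.
by rewrite ltn_subLR.
Qed.

Lemma adm_seq_inf_splice n j X U U' : adm_seq S n j X U ->
  adm_seq_inf S (j + n) (traj S j X U n) U' ->
  adm_seq_inf S j X (splice n U U').
Proof.
move=> aU aU' k.
have aU'k : adm_seq S k.+1 (j + n) (traj S j X U n) U' by move=> i _; exact: aU'.
by apply: (adm_seq_splice aU aU'k); rewrite addnS ltnS leq_addl.
Qed.

Lemma adm_seq1 j X (U0 : Omega -> UU) : adm S X U0 -> adm_seq S 1 j X (fun=> U0).
Proof. by move=> aU0 [|]. Qed.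

Section states.
Variable PW : probability (g_sigma_algebraType (@open WW)) R.
Hypothesis hS : standing_assumptions S PW.

Lemma random_var_step j X (U : Omega -> UU) :
  random_var XX X -> random_var UU U -> random_var XX (step S j X U).
Proof.
case: hS => -[sX sU sW] cdyn _ _ [rW _ _] rX rU.
have cX := separable_second_countable sX.
have cU := separable_second_countable sU.
have cW := separable_second_countable sW.
apply: (@random_var_continuous _ _ _ _ (dyn S)) cdyn _.
apply: random_var_pair => //; first exact: second_countable_prod.
exact: random_var_pair.
Qed.

(** Every continuation of the successor state extends to a control sequence
    of the present one, so that the independence required of the successor is
    part of what is known about the present state. *)
Lemma state_step j X (U : Omega -> UU) : state S j X -> adm S X U ->
  state S j.+1 (step S j X U).
Proof.
move=> [rX iX] aU; split; first by apply: random_var_step => //; case: aU.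
move=> U' aU' k; have aU1 := adm_seq1 j aU.
have := iX (splice 1 (fun=> U) U').
have E : traj S j X (fun=> U) 1 = step S j X U by rewrite /= addn0.
move=> /(_ (adm_seq_inf_splice aU1 _)); rewrite E addn1 => /(_ aU' k.+1).
rewrite (_ : splice 1 (fun=> U) U' k.+1 = U' k); last by rewrite /splice/= subn1.
by rewrite -[k.+1]add1n traj_splicer E addn1 addnA addn1.
Qed.

Lemma state_traj n j X U k : state S j X -> adm_seq S n j X U -> (k <= n)%N ->
  state S (j + k) (traj S j X U k).
Proof.
move=> sX aU; elim: k => [|k IH] kn; first by rewrite addn0.
by rewrite addnS; apply: state_step; [apply: IH; exact: ltnW|exact: aU].
Qed.

End states.

(** A stage cost that may depend on time covers the original and the rotated
    functional at once, together with their value functions. *)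
Section running_cost.
Variable c : nat -> (Omega -> XX) -> (Omega -> UU) -> \bar R.

Definition run_cost N j X U : \bar R :=
  (\sum_(k < N) c (j + k) (traj S j X U k) (U k))%E.

Definition opt_cost N j X : \bar R :=
  ereal_inf [set run_cost N j X U | U in adm_seq S N j X].

Lemma run_costD n m j X U : run_cost (n + m) j X U =
  (run_cost n j X U +
   run_cost m (j + n) (traj S j X U n) (fun i => U (n + i)%N))%E.
Proof.
rewrite /run_cost big_split_ord/=; congr (_ + _)%E; apply: eq_bigr => k _.
by rewrite traj_shift addnA.
Qed.

Lemma run_cost_splice n m j X U U' : run_cost (n + m) j X (splice n U U') =
  (run_cost n j X U + run_cost m (j + n) (traj S j X U n) U')%E.
Proof.
rewrite run_costD splice_shift traj_splicel//; congr (_ + _)%E.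
apply: eq_bigr => k _; rewrite traj_splicel ?(ltnW (ltn_ord k))//.
by rewrite /splice ltn_ord.
Qed.

Lemma opt_cost_le_run N j X U : adm_seq S N j X U ->
  (opt_cost N j X <= run_cost N j X U)%E.
Proof. by move=> aU; apply: ereal_inf_lbound; exists U. Qed.

(** The half of the dynamic programming principle that needs no minimizer. *)
Lemma opt_cost_splice n m j X U : adm_seq S n j X U ->
  run_cost n j X U \is a fin_num ->
  (opt_cost (n + m) j X <=
   run_cost n j X U + opt_cost m (j + n) (traj S j X U n))%E.
Proof.
move=> aU fU; rewrite -leeBlDl//; apply: le_ereal_inf_tmp => _ [U' aU' <-].
rewrite leeBlDl// -run_cost_splice; apply: opt_cost_le_run.
exact: adm_seq_splice.
Qed.

End running_cost.

End trajectories.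
(** * A common time close to the stationary process *)

Section turnpike_counting.
Context {R : realType}.

(** There are at least [N / 3] indices [p] with [0 < p <= N / 2], since [N >= 2];
    if the claim failed at each of them, the two sums together would be at least
    [(N / 3) * (12 * C / N) = 4 * C], but they are at most [2 * C]. *)
Lemma common_small_term (x y : nat -> \bar R) (N : nat) (C : R) :
  (2 <= N)%N -> 0 < C ->
  (forall k, (k < N)%N -> 0 <= x k)%E -> (forall k, (k < N)%N -> 0 <= y k)%E ->
  (\sum_(k < N) x k <= C%:E)%E -> (\sum_(k < N) y k <= C%:E)%E ->
  exists p, [/\ (0 < p)%N, (p * 2 <= N)%N,
    (x p <= (C / (N%:R / 12))%:E)%E & (y p <= (C / (N%:R / 12))%:E)%E].
Proof.
move=> N2 C0 x0 y0 xC yC; set c := C / _.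
have N0 : 0 < N%:R :> R by rewrite ltr0n; exact: leq_trans N2.
have c0 : 0 < c by rewrite /c !divr_gt0.
apply: contrapT => /forallNP none.
have large p : (0 < p)%N -> (p * 2 <= N)%N -> (c%:E <= x p + y p)%E.
  move=> p0 pN; have pltN : (p < N)%N by lia.
  have [xp|/ltW xp] := leP (x p) c%:E; last first.
    by apply: le_trans xp _; rewrite leeDl// y0.
  have [yp|/ltW yp] := leP (y p) c%:E; first by case: (none p).
  by apply: le_trans yp _; rewrite leeDr// x0.
pose K := N./2; have KN : (K.+1 <= N)%N by rewrite /K; lia.
have : (\sum_(k < N) (x k + y k) <= (C + C)%:E)%E.
  by rewrite big_split/= EFinD leeD.
apply/negP; rewrite -ltNge.
apply: (@lt_le_trans _ _ (\sum_(i < K) c%:E)%E).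
  rewrite sumEFin lte_fin sumr_const card_ord -[c *+ K]mulr_natr /c.
  have : (N < 6 * K)%N by rewrite /K; lia.
  rewrite -(ltr_nat R) natrM => NK.
  have -> : C / (N%:R / 12) * K%:R = C * (12 * K%:R) / N%:R.
    by field; rewrite gt_eqF.
  by rewrite ltr_pdivlMr//; nra.
rewrite -(subnKC KN) -[K.+1]add1n -addnA big_split_ord/= big_split_ord/=.
apply: (@le_trans _ _ (\sum_(i < K) (x (1 + i)%N + y (1 + i)%N))%E).
  by apply: lee_sum => i _; apply: large; have := ltn_ord i; rewrite /K; lia.
have tail0 k : (k < N)%N -> (0 <= x k + y k)%E.
  by move=> kN; rewrite adde_ge0 ?x0 ?y0.
apply: le_trans (leeDr _ _); last first.
  by apply: sume_ge0 => i _; apply: tail0 => /=; have := ltn_ord i; lia.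
by apply: leeDl; apply: sume_ge0 => i _; apply: tail0 => /=; have := ltn_ord i; lia.
Qed.

End turnpike_counting.

(** * The rotated problem *)

Section rotation.
Context {R : realType} {disp : measure_display} {Omega : measurableType disp}.
Context {P : probability Omega R} {XX UU WW : completeNormedModType R}.
Variables (S : control_problem P XX UU WW).
Variable PW : probability (g_sigma_algebraType (@open WW)) R.
Hypothesis hS : standing_assumptions S PW.
Variable d : (Omega -> XX) -> (Omega -> XX) -> \bar R.
Hypothesis hd : pseudometric_on (random_var XX) d.
Variables (Xs : nat -> Omega -> XX) (Us : nat -> Omega -> UU).
Hypothesis hs : stationary_pair S Xs Us.
Hypothesis hls : ell_s S Xs Us \is a fin_num.
Variables (lam : nat -> (Omega -> XX) -> R) (alpha : R -> R).
Hypothesis hdiss : strictly_dissipative S Xs Us d lam alpha.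
Implicit Types (X : Omega -> XX) (U : nat -> Omega -> UU) (j k n m N : nat).

Local Notation ls := (fine (ell_s S Xs Us)).
Local Notation tell := (tell S Xs Us lam).
Local Notation tJ := (tJ S Xs Us lam).
Local Notation tV := (tV S Xs Us lam).
Local Notation dist j X := (d X (Xs j)).

Lemma class_Kinf_alpha : class_Kinf alpha. Proof. by case: hdiss. Qed.

Lemma traj_stationary k : traj S 0 (Xs 0%N) Us k = Xs k.
Proof.
by case: hs => _ sXs _ _; elim: k => //= k ->; rewrite sXs add0n.
Qed.

Lemma state_stationary j : state S j (Xs j).
Proof.
case: hs => s0 _ aUs _; rewrite -traj_stationary.
have aj : adm_seq S j 0 (Xs 0%N) Us by move=> k _; exact: aUs.
exact: (state_traj hS s0 aj).
Qed.

Lemma traj_stationary_shift j k :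
  traj S j (Xs j) (fun i => Us (j + i)%N) k = Xs (j + k)%N.
Proof. by rewrite -[RHS]traj_stationary traj_shift traj_stationary. Qed.

Lemma adm_stationary j k : adm S (Xs (j + k)%N) (Us (j + k)%N).
Proof. by case: hs => _ _ aUs _; rewrite -traj_stationary. Qed.

Lemma dist_ge0 j X : state S j X -> (0 <= dist j X)%E.
Proof. by case: hd => d0 _ _ _ [rX _]; apply: d0 => //; case: (state_stationary j). Qed.

Lemma dist_stationary j : dist j (Xs j) = 0%E.
Proof. by case: hd => _ d0 _ _; apply: d0; case: (state_stationary j). Qed.

Lemma cball_stationary j e : 0 <= e -> cball S Xs d e%:E j (Xs j).
Proof. by move=> e0; split; [exact: state_stationary|rewrite dist_stationary]. Qed.

Lemma ell_tell j X (U : Omega -> UU) :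
  ell S X U =
  (tell j X U + (ls - lam j X + lam j.+1 (step S j X U))%:E)%E.
Proof.
rewrite /Defs.tell -{1}(fineK hls); case: (ell S X U) => //= z.
by rewrite -!(EFinD, EFinN, EFinB); congr EFin; ring.
Qed.

(** The storage terms telescope; as [lam] is real-valued, this also holds for
    infinite costs. *)
Lemma J_tJ N j X U : J S N j X U = (tJ N j X U +
  (N%:R * ls - lam j X + lam (j + N)%N (traj S j X U N))%:E)%E.
Proof.
rewrite /J /Defs.tJ; elim: N => [|N IH].
  by rewrite !big_ord0 addn0 add0e/= mul0r sub0r addNr.
rewrite !big_ord_recr/= IH (ell_tell (j + N)) addeACA; congr (_ + _)%E.
by rewrite -EFinD; congr EFin; rewrite addnS -natr1; ring.
Qed.

Lemma alpha_dist_le_tell j X (U : Omega -> UU) : state S j X -> adm S X U ->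
  (er_map alpha (dist j X) <= tell j X U)%E.
Proof. by case: hdiss => _ _; apply. Qed.

Lemma alpha_dist_ge0 j X : state S j X -> (0 <= er_map alpha (dist j X))%E.
Proof.
by move=> sX; apply: er_map_ge0; [case: class_Kinf_alpha|exact: dist_ge0].
Qed.

Lemma tell_ge0 j X (U : Omega -> UU) : state S j X -> adm S X U ->
  (0 <= tell j X U)%E.
Proof.
by move=> sX aU; apply: le_trans (alpha_dist_ge0 sX) (alpha_dist_le_tell sX aU).
Qed.

Lemma tell_traj_ge0 N j X U k : state S j X -> adm_seq S N j X U -> (k < N)%N ->
  (0 <= tell (j + k) (traj S j X U k) (U k))%E.
Proof.
move=> sX aU kN; apply: tell_ge0; last exact: aU.
exact: (state_traj hS sX aU (ltnW kN)).
Qed.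

Lemma tJ_ge0 N j X U : state S j X -> adm_seq S N j X U -> (0 <= tJ N j X U)%E.
Proof. by move=> sX aU; apply: sume_ge0 => k _; exact: (tell_traj_ge0 sX aU). Qed.

Lemma tJ_homo n N j X U : state S j X -> adm_seq S N j X U -> (n <= N)%N ->
  (tJ n j X U <= tJ N j X U)%E.
Proof.
move=> sX aU nN; rewrite -{1 2}(subnKC nN) in aU *.
rewrite [leRHS](run_costD _ _ n (N - n)) leeDl//; apply: tJ_ge0.
  exact: (state_traj hS sX aU (leq_addr _ _)).
exact: adm_seq_shift.
Qed.

Lemma sum_alpha_dist_le_tJ N j X U : state S j X -> adm_seq S N j X U ->
  (\sum_(k < N) er_map alpha (dist (j + k)%N (traj S j X U k)) <= tJ N j X U)%E.
Proof.
move=> sX aU; apply: lee_sum => k _; apply: alpha_dist_le_tell; last exact: aU.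
exact: (state_traj hS sX aU (ltnW (ltn_ord k))).
Qed.

Lemma tV_ge0 N j X : state S j X -> (0 <= tV N j X)%E.
Proof.
by move=> sX; apply: le_ereal_inf_tmp => _ [U aU <-]; exact: tJ_ge0.
Qed.

Lemma tV_homo n N j X : state S j X -> (n <= N)%N -> (tV n j X <= tV N j X)%E.
Proof.
move=> sX nN; apply: le_ereal_inf_tmp => _ [U aU <-].
by apply: le_trans (tJ_homo sX aU nN); apply: opt_cost_le_run; exact: adm_seqW aU.
Qed.

Lemma alpha_dist_le_tV N j X : state S j X -> (0 < N)%N ->
  (er_map alpha (dist j X) <= tV N j X)%E.
Proof.
move=> sX N0; apply: le_ereal_inf_tmp => _ [U aU <-].
apply: le_trans (tJ_homo sX aU N0); rewrite /Defs.tJ big_ord1 addn0.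
by apply: alpha_dist_le_tell => //; exact: (aU 0%N).
Qed.

Section cost_vanishes_at_stationary.
Hypothesis htell0 : forall j, tell j (Xs j) (Us j) = 0%E.

Lemma tV_stationary N j : tV N j (Xs j) = 0%E.
Proof.
apply/le_anti; rewrite tV_ge0 ?andbT; last exact: state_stationary.
have aUs : adm_seq S N j (Xs j) (fun i => Us (j + i)%N).
  by move=> k _; rewrite traj_stationary_shift; exact: adm_stationary.
apply: le_trans (opt_cost_le_run _ aUs) _; rewrite /run_cost big1// => k _.
by rewrite traj_stationary_shift htell0.
Qed.

Variables (tr : R) (gtV : R -> R).
Hypothesis KgtV : class_Kinf gtV.
Hypothesis htV : forall N j X, cball S Xs d tr%:E j X ->
  (`|tV N j X - tV N j (Xs j)| <= er_map gtV (dist j X))%E.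

Lemma tV_le_dist N j X : cball S Xs d tr%:E j X ->
  (tV N j X <= er_map gtV (dist j X))%E.
Proof.
move=> /(htV N); rewrite tV_stationary sube0; apply: le_trans.
exact: lee_abs.
Qed.

Lemma tV_le_radius N j X rho : rho <= tr -> cball S Xs d rho%:E j X ->
  (tV N j X <= (gtV rho)%:E)%E.
Proof.
move=> rhotr [sX dX]; apply: le_trans (tV_le_dist N _) _.
  by split=> //; apply: le_trans dX _.
by case: KgtV => KgtV' _; apply: er_map_le => //; exact: dist_ge0.
Qed.

Variables (r CV Clam Claml : R).
Hypotheses (hr : 0 < r) (hCV : 0 < CV) (hClam : 0 < Clam) (hClaml : 0 < Claml).
Hypothesis hlam_bound : forall j X, cball S Xs d r%:E j X -> `|lam j X| <= Clam.
Hypothesis hlam_lower : forall j X, state S j X -> - Claml <= lam j X.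
Hypothesis hcheap : cheaply_reachable S Xs Us d r CV.

Local Notation C := (Clam + Claml + CV).

Lemma V_le_cheap N j X : cball S Xs d r%:E j X ->
  (V S N j X <= (CV + N%:R * ls)%:E)%E.
Proof.
move=> /(hcheap N); rewrite -(fineK hls) -EFinM leeBlDr// -EFinD.
Qed.

Lemma J_ge N j X U : state S j X -> adm_seq S N j X U ->
  ((N%:R * ls - lam j X - Claml)%:E <= J S N j X U)%E.
Proof.
move=> sX aU; rewrite J_tJ -[leLHS]add0e leeD ?tJ_ge0// lee_fin.
have := hlam_lower (state_traj hS sX aU (leqnn N)); lra.
Qed.

Lemma V_fin_num N j X : cball S Xs d r%:E j X -> V S N j X \is a fin_num.
Proof.
move=> bX; have ub := V_le_cheap N bX; case: (bX) => sX _.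
have lb : ((N%:R * ls - lam j X - Claml)%:E <= V S N j X)%E.
  by apply: le_ereal_inf_tmp => _ [U aU <-]; exact: J_ge.
by rewrite fin_numElt (lt_le_trans (ltNyr _) lb) (le_lt_trans ub (ltry _)).
Qed.

Lemma minimizer_V N j X U : minimizer S N j X U -> J S N j X U = V S N j X.
Proof.
move=> [aU mU]; apply/le_anti/andP; split; last first.
  exact: (opt_cost_le_run (fun=> ell S)).
by apply: le_ereal_inf_tmp => _ [U' aU' <-]; exact: mU.
Qed.

(** Cheap reachability bounds the original cost of a minimizer, and the storage
    terms by which the rotated cost differs are bounded as well. *)
Lemma minimizer_tJ_le N j X U : cball S Xs d r%:E j X -> minimizer S N j X U ->
  (tJ N j X U <= C%:E)%E.
Proof.
move=> bX mU; have := V_le_cheap N bX; rewrite -(minimizer_V mU) J_tJ.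
rewrite -leeBrDr// -EFinB => /le_trans; apply; rewrite lee_fin.
have := hlam_lower (state_traj hS bX.1 mU.1 (leqnn N)).
have := hlam_bound bX; rewrite ler_norml => /andP[? ?] ?; lra.
Qed.

Variables (teps : R) (glam : R -> R).
Hypotheses (htr : teps <= tr) (Kglam : class_K glam).
Hypothesis hlam : forall j X, cball S Xs d teps%:E j X ->
  (`|lam j X - lam j (Xs j)|%:E <= er_map glam (dist j X))%E.

Lemma lam_near j X rho : rho <= teps -> cball S Xs d rho%:E j X ->
  `|lam j X - lam j (Xs j)| <= glam rho.
Proof.
move=> rhoe [sX dX]; rewrite -lee_fin; apply: le_trans (hlam _) _.
  by split=> //; apply: le_trans dX _.
by apply: er_map_le => //; exact: dist_ge0.
Qed.

Variables (eps : R) (gV : R -> R -> R).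
Hypothesis hgV_mono1 : forall (rho N N' : R), 0 <= rho -> 0 <= N -> N <= N' ->
  gV N' rho <= gV N rho.
Hypothesis hgV_mono2 : forall (N rho rho' : R), 0 <= N -> 0 <= rho -> rho <= rho' ->
  gV N rho <= gV N rho'.
Hypothesis hV : forall N j X, cball S Xs d eps%:E j X ->
  (`|V S N j X - V S N j (Xs j)| <= er_map (gV N%:R) (dist j X))%E.

Lemma V_near N (M : R) j X rho : rho <= eps -> 0 <= M <= N%:R ->
  cball S Xs d rho%:E j X ->
  exists2 v, V S N j X = v%:E & `|v - fine (V S N j (Xs j))| <= gV M rho.
Proof.
move=> rhoe /andP[M0 MN] [sX dX].
have fVs := V_fin_num N (cball_stationary j (ltW hr)).
have bX : cball S Xs d eps%:E j X by split=> //; apply: le_trans dX _.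
have := hV N bX; have := dist_ge0 sX; rewrite -(fineK fVs).
case: (dist j X) dX => //= t; rewrite !lee_fin => trho t0.
have gle : gV N%:R t <= gV M rho.
  apply: (@le_trans _ _ (gV M t)); first exact: hgV_mono1.
  exact: hgV_mono2.
case: (V S N j X) => //= v; rewrite lee_fin => h.
by exists v => //; exact: le_trans gle.
Qed.

(** Cut a minimizer [U] of the original problem and an almost-minimizer [U']
    of the rotated one at a common time [p <= N / 2] at which both are close to
    the stationary process.  There the two tails have almost equal original
    values and the storage function almost equal values, so the optimality of
    [U] carries over to the rotated cost of its first [p] steps.  Continuing
    these steps, with the first one removed, by an almost optimal control for
    the rotated problem costs little, and estimates the rotated value of the
    successor state. *)
Lemma rotated_value_decrease N j X U :
  let rho := inv_Kinf alpha (C / (N%:R / 12)) in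
  (2 <= N)%N -> rho <= eps -> rho <= teps ->
  cball S Xs d r%:E j X -> (tV N j X <= (C / 2)%:E)%E ->
  minimizer S N j X U ->
  (tell j X (U 0%N) + tV N j.+1 (step S j X (U 0%N)) <=
   tV N j X + (gtV rho + 2 * glam rho + 2 * gV (N%:R / 2) rho)%:E)%E.
Proof.
move=> rho N2 rhoe rhote bX tVC mU; have [sX _] := bX.
have aU := mU.1.
have C0 : 0 < C by rewrite !addr_gt0.
have c0 : 0 <= C / (N%:R / 12) by rewrite !divr_ge0// ltW.
have near_rho k X' : state S k X' ->
    (er_map alpha (dist k X') <= (C / (N%:R / 12))%:E)%E -> (dist k X' <= rho%:E)%E.
  by move=> sX'; apply: er_map_le_inv => //; [exact: class_Kinf_alpha|exact: dist_ge0].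
clearbody rho.
have N0 : 0 < N%:R :> R by rewrite ltr0n; exact: leq_trans N2.
have tV0 : (0 <= tV N j X)%E by exact: tV_ge0.
have ftV : tV N j X \is a fin_num.
  by rewrite ge0_fin_numE//; apply: le_lt_trans tVC (ltry _).
apply/lee_addgt0Pr => e e0.
(* the bound [C / 2] keeps the rotated cost of the almost-minimizer below [C] *)
pose e' : R := Num.min e (C / 2).
have e'0 : 0 < e' by rewrite lt_min e0 divr_gt0.
have [e'e e'C] : e' <= e /\ e' <= C / 2 by rewrite !ge_min !lexx orbT.
clearbody e'.
have [_ [U' aU' <-] /ltW tJU'] := lb_ereal_inf_adherent e'0 ftV.
rewrite -[ereal_inf _]/(tV N j X) -[X in (X <= _)%E]/(tJ N j X U') in tJU'.
have tJUC := minimizer_tJ_le bX mU.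
have tJU'C : (tJ N j X U' <= C%:E)%E.
  apply: le_trans tJU' _; rewrite [C]splitr EFinD; exact: leeD.
have [p [p0 pN]] : exists p, [/\ (0 < p)%N, (p * 2 <= N)%N,
    (er_map alpha (dist (j + p)%N (traj S j X U p)) <= (C / (N%:R / 12))%:E)%E &
    (er_map alpha (dist (j + p)%N (traj S j X U' p)) <= (C / (N%:R / 12))%:E)%E].
  apply: (@common_small_term R
    (fun k => er_map alpha (dist (j + k)%N (traj S j X U k)))
    (fun k => er_map alpha (dist (j + k)%N (traj S j X U' k)))) => //.
  - by move=> k /ltnW kN; apply: alpha_dist_ge0; exact: (state_traj hS sX aU).
  - by move=> k /ltnW kN; apply: alpha_dist_ge0; exact: (state_traj hS sX aU').
  - exact: le_trans (sum_alpha_dist_le_tJ sX aU) tJUC.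
  - exact: le_trans (sum_alpha_dist_le_tJ sX aU') tJU'C.
have ltpN : (p <= N)%N by apply: leq_trans pN; rewrite leq_pmulr.
have sU := state_traj hS sX aU ltpN; have sU' := state_traj hS sX aU' ltpN.
move=> /(near_rho _ _ sU) dU /(near_rho _ _ sU') dU'.
have bU : cball S Xs d rho%:E (j + p) (traj S j X U p) by [].
have bU' : cball S Xs d rho%:E (j + p) (traj S j X U' p) by [].
have M2 : 0 <= (N%:R : R) / 2 <= (N - p)%:R.
  have : p%:R * 2 <= N%:R :> R by rewrite -natrM ler_nat.
  by rewrite natrB// => ?; apply/andP; split; lra.
have [v1 Ev1 Hv1] := V_near rhoe M2 bU.
have [v2 Ev2 Hv2] := V_near rhoe M2 bU'.
have Hl1 := lam_near rhote bU; have Hl2 := lam_near rhote bU'.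
have aUp := adm_seqW ltpN aU; have aU'p := adm_seqW ltpN aU'.
have [t1 Et1] : exists t, tJ p j X U = t%:E.
  exists (fine (tJ p j X U)); rewrite fineK// ge0_fin_numE ?tJ_ge0//.
  by apply: le_lt_trans (tJ_homo sX aU ltpN) (le_lt_trans tJUC (ltry _)).
have [t2 Et2] : exists t, tJ p j X U' = t%:E.
  exists (fine (tJ p j X U')); rewrite fineK// ge0_fin_numE ?tJ_ge0//.
  by apply: le_lt_trans (tJ_homo sX aU' ltpN) (le_lt_trans tJU'C (ltry _)).
(* optimality of U against the concatenation of U' with optimal tails *)
have t12 : t1 <= t2 + 2 * glam rho + 2 * gV (N%:R / 2) rho.
  have lo : ((t1 + (p%:R * ls - lam j X + lam (j + p)%N (traj S j X U p)))%:E +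
             v1%:E <= J S N j X U)%E.
    rewrite -{1 2}(subnKC ltpN) in aU *.
    rewrite [leRHS](run_costD S (fun=> ell S) p (N - p)) leeD//.
      by rewrite [leRHS](J_tJ p) Et1.
    by rewrite -Ev1; apply: opt_cost_le_run; exact: adm_seq_shift.
  have up : (V S N j X <=
             (t2 + (p%:R * ls - lam j X + lam (j + p)%N (traj S j X U' p)))%:E +
             v2%:E)%E.
    have EJ : J S p j X U' =
        (t2 + (p%:R * ls - lam j X + lam (j + p)%N (traj S j X U' p)))%:E.
      by rewrite J_tJ Et2.
    rewrite -EJ -Ev2 -{1}(subnKC ltpN).
    have fJ : run_cost S (fun=> ell S) p j X U' \is a fin_num.
      by change (J S p j X U' \is a fin_num); rewrite EJ.
    exact: opt_cost_splice fJ.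
  have := le_trans lo; rewrite (minimizer_V mU) => /(_ _ up).
  rewrite -!EFinD lee_fin.
  move: Hv1 Hv2 Hl1 Hl2; rewrite !ler_norml.
  by move=> /andP[? ?] /andP[? ?] /andP[? ?] /andP[? ?]; lra.
have t2e : (t2%:E <= tV N j X + e'%:E)%E.
  by rewrite -Et2; apply: le_trans (tJ_homo sX aU' ltpN) tJU'.
case: p p0 => // p _ in pN ltpN sU sU' dU dU' bU bU' M2 Ev1 Hv1 Ev2 Hv2 Hl1 Hl2
  aUp aU'p Et1 Et2 t12 *.
have := Et1; rewrite -[X in tJ X](add1n p) [tJ _ _ _ _](run_costD S tell 1 p).
rewrite {1}/run_cost big_ord1/= addn0 addn1 => Esplit.
have aU1 : adm S X (U 0%N) by apply: (aU 0%N); exact: leq_trans N2.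
have aUtail : adm_seq S p j.+1 (step S j X (U 0%N)) (fun i => U (1 + i)%N).
  have := @adm_seq_shift _ _ _ _ _ _ _ S 1 p j X U.
  by rewrite /= addn0 addn1; apply; rewrite add1n.
have s1 : state S j.+1 (step S j X (U 0%N)) by exact: (state_step hS).
have tell0 := tell_ge0 sX aU1.
have tJtail0 := tJ_ge0 s1 aUtail.
have [a Ea] : exists a, tell j X (U 0%N) = a%:E.
  exists (fine (tell j X (U 0%N))); rewrite fineK// ge0_fin_numE//.
  by apply: le_lt_trans (ltry t1); rewrite -Esplit leeDl.
have [b Eb] : exists b, tJ p j.+1 (step S j X (U 0%N)) (fun i => U (1 + i)%N) = b%:E.
  exists (fine (tJ p j.+1 (step S j X (U 0%N)) (fun i => U (1 + i)%N))).
  rewrite fineK// ge0_fin_numE//.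
  by apply: le_lt_trans (ltry t1); rewrite -Esplit leeDr.
have ab : a + b = t1.
  by apply: EFin_inj; rewrite EFinD -Ea -Eb -Esplit.
(* drop the first step of U; at time p, continue as the rotated problem demands *)
have tVnext : (tV N j.+1 (step S j X (U 0%N)) <= (b + gtV rho)%:E)%E.
  have pN' : (p <= N)%N by exact: ltnW.
  rewrite -{1}(subnKC pN'); have ftail : run_cost S tell p j.+1 (step S j X (U 0%N))
      (fun i => U (1 + i)%N) \is a fin_num.
    by change (tJ p j.+1 (step S j X (U 0%N)) (fun i => U (1 + i)%N) \is a fin_num);
      rewrite Eb.
  apply: le_trans (opt_cost_splice _ aUtail ftail) _.
  rewrite EFinD -Eb leeD2l//.
  have -> : traj S j.+1 (step S j X (U 0%N)) (fun i => U (1 + i)%N) p =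
            traj S j X U p.+1.
    by rewrite -[p.+1]add1n traj_shift/= addn0 addn1.
  rewrite addSnnS; apply: tV_le_radius => //; exact: le_trans htr.
rewrite Ea; apply: le_trans (leeD2l _ tVnext) _.
rewrite -EFinD -addeA -EFinD; move: t2e; rewrite -(fineK ftV) -!EFinD !lee_fin.
lra.
Qed.

(** * Stability and performance of the closed loop *)

Section closed_loop_analysis.
Variable mu : nat -> nat -> (Omega -> XX) -> Omega -> UU.
Hypothesis hmu : mpc_feedback S mu.
Variables (th0 radius : R) (err : nat -> R) (N0 : nat).
Hypotheses (radius_gt0 : 0 < radius) (radius_tr : radius <= tr).
Hypothesis th0_radius : th0 <= alpha radius.
Hypotheses (N0_gt0 : (0 < N0)%N) (err_ge0 : forall N, 0 <= err N).
Local Notation Y N := (sublevel S Xs Us lam N th0).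
Hypothesis decrease : forall N j X, (N0 <= N)%N -> Y N j X ->
  (tell j X (mu N j X) + tV N j.+1 (cl_step S (mu N) j X) <=
   tV N j X + (err N)%:E)%E.

Local Notation D j X := (fine (dist j X)).
Local Notation W N j X := (fine (tV N j X)).
Local Notation next N j X := (cl_step S (mu N) j X).
Local Notation T N j X := (fine (tell j X (mu N j X))).

Lemma adm_mu N j X : (N0 <= N)%N -> state S j X -> adm S X (mu N j X).
Proof.
move=> NN sX; have Npos := leq_trans N0_gt0 NN.
by have [U [aU _] ->] := hmu Npos sX; exact: (aU 0%N).
Qed.

Lemma sublevel_distE N j X : (N0 <= N)%N -> Y N j X ->
  dist j X = (D j X)%:E /\ 0 <= D j X <= radius.
Proof.
move=> NN [sX /andP[_ tVX]]; have d0 := dist_ge0 sX.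
have [Ka _] := class_Kinf_alpha.
have ar0 := class_K_ge0 Ka (ltW radius_gt0).
have /(er_map_le_inv class_Kinf_alpha d0 ar0) dr :
    (er_map alpha (dist j X) <= (alpha radius)%:E)%E.
  apply: le_trans (alpha_dist_le_tV sX (leq_trans N0_gt0 NN)) _.
  by apply: le_trans tVX _; rewrite lee_fin.
rewrite (inv_KinfK class_Kinf_alpha (ltW radius_gt0)) in dr.
have fd : dist j X \is a fin_num by rewrite ge0_fin_numE// (le_lt_trans dr (ltry _)).
by split; [rewrite fineK|rewrite -!lee_fin fineK// d0 dr].
Qed.

Lemma sublevel_cball N j X : (N0 <= N)%N -> Y N j X -> cball S Xs d radius%:E j X.
Proof.
move=> NN YX; split; first by case: YX.
by case: (sublevel_distE NN YX) => -> /andP[_]; rewrite lee_fin.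
Qed.

Lemma sublevel_value N j X : (N0 <= N)%N -> Y N j X ->
  [/\ tV N j X = (W N j X)%:E, alpha (D j X) <= W N j X,
      W N j X <= gtV (D j X) & W N j X <= th0].
Proof.
move=> NN YX; have [sX /andP[tV0 tVX]] := YX.
have [dE /andP[D0 Dr]] := sublevel_distE NN YX.
have WE : tV N j X = (W N j X)%:E.
  by rewrite fineK// ge0_fin_numE// (le_lt_trans tVX (ltry _)).
split=> //; rewrite -lee_fin -WE//.
  by have := alpha_dist_le_tV sX (leq_trans N0_gt0 NN); rewrite dE.
have := @tV_le_dist N j X; rewrite dE; apply; split=> //.
by rewrite dE lee_fin (le_trans Dr).
Qed.

Lemma sublevel_next N j X : (N0 <= N)%N -> Y N j X ->
  [/\ state S j.+1 (next N j X), tell j X (mu N j X) = (T N j X)%:E,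
      tV N j.+1 (next N j X) = (W N j.+1 (next N j X))%:E,
      0 <= W N j.+1 (next N j X) /\ alpha (D j X) <= T N j X &
      T N j X + W N j.+1 (next N j X) <= W N j X + err N].
Proof.
move=> NN YX; have [sX _] := YX; have aX := adm_mu NN sX.
have s1 : state S j.+1 (next N j X) by exact: (state_step hS).
have T0 := tell_ge0 sX aX; have W0 := tV_ge0 N s1.
have [WE _ _ _] := sublevel_value NN YX.
have [dE _] := sublevel_distE NN YX.
have dec := decrease NN YX; rewrite WE -EFinD in dec.
have TE : tell j X (mu N j X) = (T N j X)%:E.
  rewrite fineK// ge0_fin_numE//; apply: le_lt_trans (le_lt_trans dec (ltry _)).
  by rewrite leeDl.
have W1E : tV N j.+1 (next N j X) = (W N j.+1 (next N j X))%:E.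
  rewrite fineK// ge0_fin_numE//; apply: le_lt_trans (le_lt_trans dec (ltry _)).
  by rewrite leeDr.
split=> //; last by rewrite -lee_fin EFinD -TE -W1E.
split; first exact: fine_ge0.
by rewrite -lee_fin -TE; have := alpha_dist_le_tell sX aX; rewrite dE.
Qed.

(** Since the value is at most [gtV] of the distance, this bounds the decrease
    [alpha] of the distance from below in terms of the value. *)
Definition decay (v : R) : R := alpha (inv_Kinf gtV v).

Lemma class_Kinf_decay : class_Kinf decay.
Proof.
by apply: class_Kinf_comp; [exact: class_Kinf_alpha|exact: class_Kinf_inv].
Qed.

Lemma decay_value_le N j X : (N0 <= N)%N -> Y N j X ->
  decay (W N j X) <= alpha (D j X).
Proof.
move=> NN YX; have [_ aW WD _] := sublevel_value NN YX.
have [_ /andP[D0 _]] := sublevel_distE NN YX.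
have [Ka _] := class_Kinf_alpha; have [Kig _] := class_Kinf_inv KgtV.
have W0 : 0 <= W N j X by apply: le_trans aW; exact: class_K_ge0.
rewrite /decay; apply: class_K_le => //; first exact: inv_Kinf_ge0.
by rewrite -[leRHS](inv_KinfK KgtV D0); exact: class_K_le.
Qed.

Variable delta : R -> R.
Hypothesis delta_th0 : forall N, (N0 <= N)%N -> delta N%:R <= th0.
Hypothesis delta_err : forall N, (N0 <= N)%N ->
  2 * (inv_Kinf decay (2 * err N) + err N) <= delta N%:R.
Local Notation Q N := (sublevel S Xs Us lam N (delta N%:R)).

Let inv_decay_ge0 N : 0 <= inv_Kinf decay (2 * err N).
Proof. by apply: inv_Kinf_ge0; [exact: class_Kinf_decay|rewrite mulr_ge0]. Qed.

Lemma delta_ge0 N : (N0 <= N)%N -> 0 <= delta N%:R.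
Proof.
by move=> /delta_err; apply: le_trans; rewrite mulr_ge0// addr_ge0.
Qed.

(** This is what [delta] is chosen for: above half its height, the error uses up
    at most half of the decrease. *)
Lemma error_absorbed N j X : (N0 <= N)%N -> Y N j X ->
  delta N%:R / 2 <= W N j X -> 2 * err N <= alpha (D j X).
Proof.
move=> NN YX dW; apply: le_trans (decay_value_le NN YX).
have Kd := class_Kinf_decay; have := delta_err NN; have := err_ge0 N => e0 de.
rewrite -[leLHS](Kinf_invK Kd); last by rewrite mulr_ge0.
by apply: class_K_le => //; [case: Kd|lra].
Qed.

Lemma sublevelE N a j X : state S j X -> tV N j X = (W N j X)%:E ->
  sublevel S Xs Us lam N a j X <-> W N j X <= a.
Proof.
move=> sX WE; rewrite /sublevel/= tV_ge0//= WE lee_fin.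
by split=> [[]|].
Qed.

Lemma target_sublevel N j X : (N0 <= N)%N -> Q N j X -> Y N j X.
Proof.
move=> NN [sX /andP[tV0 tVX]]; split=> //; rewrite tV0/=.
by apply: le_trans tVX _; rewrite lee_fin delta_th0.
Qed.

Lemma target_invariant N : (N0 <= N)%N -> forward_invariant S (mu N) (Q N).
Proof.
move=> NN j X QX; have YX := target_sublevel NN QX.
have [s1 _ W1E [W10 aT] dec] := sublevel_next NN YX.
have [WE _ _ _] := sublevel_value NN YX; have [sX _] := YX.
have /(sublevelE _ sX WE) Wd := QX.
apply/(sublevelE _ s1 W1E).
have [_ /andP[D0 _]] := sublevel_distE NN YX.
have a0 : 0 <= alpha (D j X) by apply: class_K_ge0 => //; case: class_Kinf_alpha.
have e0 := err_ge0 N; have de := delta_err NN; have i0 := inv_decay_ge0 N.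
have [/(error_absorbed NN YX) ab|Wd2] := leP (delta N%:R / 2) (W N j X).
  lra.
lra.
Qed.

Lemma decrease_off_target N j X : (N0 <= N)%N -> Y N j X -> ~ Q N j X ->
  W N j.+1 (next N j X) <= W N j X - alpha (D j X) / 2.
Proof.
move=> NN YX nQ; have [s1 _ W1E [W10 aT] dec] := sublevel_next NN YX.
have [WE _ _ _] := sublevel_value NN YX; have [sX _] := YX.
have d0 := delta_ge0 NN.
have /negP : ~ (W N j X <= delta N%:R) by move=> /(sublevelE _ sX WE).
rewrite -ltNge => dW; have := error_absorbed NN YX ltac:(lra); lra.
Qed.

Lemma sublevel_invariant N : (N0 <= N)%N -> forward_invariant S (mu N) (Y N).
Proof.
move=> NN j X YX; have [QX|nQ] := pselect (Q N j X).
  by apply: target_sublevel => //; exact: target_invariant.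
have [s1 _ W1E [W10 aT] dec] := sublevel_next NN YX.
apply/(sublevelE _ s1 W1E); have := decrease_off_target NN YX nQ.
have [_ _ _ Wth] := sublevel_value NN YX.
have [_ /andP[D0 _]] := sublevel_distE NN YX.
have : 0 <= alpha (D j X) by apply: class_K_ge0 => //; case: class_Kinf_alpha.
lra.
Qed.

Lemma lyapunov_off_target N : (N0 <= N)%N ->
  lyapunov S Xs d (mu N) (fun j => Y N j `\` Q N j) (tV N).
Proof.
move=> NN; split.
  move=> j X [YX _]; have [WE _ _ _] := sublevel_value NN YX.
  by case: YX => _ /andP[-> _]/=; rewrite WE ltry.
exists alpha, gtV, (fun x => 2^-1 * alpha x); split=> //.
- exact: class_Kinf_alpha.
- by apply: class_K_scale; [rewrite invr_gt0|case: class_Kinf_alpha].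
move=> j X [YX nQ] _; have [dE _] := sublevel_distE NN YX.
have [WE aW WD _] := sublevel_value NN YX.
have [_ _ W1E _ _] := sublevel_next NN YX.
have := decrease_off_target NN YX nQ.
by rewrite dE WE W1E/= !lee_fin mulrC => ?; split.
Qed.

Local Notation cl N j X k := (cl_traj S (mu N) j X k).

Lemma sublevel_cl_traj N j X k : (N0 <= N)%N -> Y N j X ->
  Y N (j + k)%N (cl N j X k).
Proof.
move=> NN YX; elim: k => [|k IH]; first by rewrite addn0.
by rewrite addnS/=; exact: sublevel_invariant.
Qed.

(** The left-hand side does not increase with [k]: a step takes at least half of
    [decay] of the current value off the value, which pays for the additional
    multiple, and [decay] of the new value is not larger than that of the old. *)
Lemma value_decay_le N j X k : (N0 <= N)%N -> Y N j X ->
  ~ Q N (j + k)%N (cl N j X k) ->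
  W N (j + k) (cl N j X k) + k%:R * (2^-1 * decay (W N (j + k) (cl N j X k)))
    <= W N j X.
Proof.
move=> NN YX; elim: k => [|k IH] nQ; first by rewrite addn0/= mul0r addr0.
have nQk : ~ Q N (j + k)%N (cl N j X k).
  by move=> Qk; apply: nQ; rewrite addnS; exact: target_invariant.
have Yk := sublevel_cl_traj k NN YX.
have := decrease_off_target NN Yk nQk; have := IH nQk.
have := decay_value_le NN Yk.
have [_ _ _ [W0 _] _] := sublevel_next NN Yk.
rewrite addnS [cl N j X k.+1]/=.
set v := W N (j + k) _; set v' := W N _ (cl_step _ _ _ _) => dv IHk v'v.
have [_ /andP[D0 _]] := sublevel_distE NN Yk.
have a0 : 0 <= alpha (D (j + k) (cl N j X k)).
  by apply: class_K_ge0 => //; case: class_Kinf_alpha.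
have [Kd _] := class_Kinf_decay.
have : decay v' <= decay v by apply: class_K_le => //; lra.
rewrite -natr1; have : 0 <= k%:R :> R by [].
by nra.
Qed.

(** The bound on the distance that [value_decay_le] yields when the value is
    estimated from below by [alpha] of the distance at the time considered, and
    by [gtV] of the distance from above at the start. *)
Definition attraction (s t : R) : R :=
  inv_Kinf (fun x => 2^-1 * decay (alpha x)) (gtV s / (1 + t)).

Lemma class_Kinf_decay_alpha : class_Kinf (fun x => 2^-1 * decay (alpha x)).
Proof.
apply: class_Kinf_scale; first by rewrite invr_gt0.
by apply: class_Kinf_comp; [exact: class_Kinf_decay|exact: class_Kinf_alpha].
Qed.

Lemma class_KL_attraction : class_KL attraction.
Proof. by apply: class_KL_inv_quotient => //; exact: class_Kinf_decay_alpha. Qed.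

Lemma cl_dist_off_target N j X k : (N0 <= N)%N -> Y N j X ->
  ~ Q N (j + k)%N (cl N j X k) ->
  D (j + k) (cl N j X k) <= attraction (D j X) k%:R.
Proof.
move=> NN YX nQ; have Yk := sublevel_cl_traj k NN YX.
have := value_decay_le NN YX nQ; have := decrease_off_target NN Yk nQ.
have := decay_value_le NN Yk.
have [_ _ _ [W0 _] _] := sublevel_next NN Yk.
have [_ aW _ _] := sublevel_value NN Yk.
have [_ _ WD _] := sublevel_value NN YX.
have [_ /andP[D0 _]] := sublevel_distE NN Yk.
move: W0 aW D0; set v := W N (j + k) _; set v' := W N _ (cl_step _ _ _ _).
set t := D (j + k) _ => W0 aW D0 dv v'v vk.
have [Ka _] := class_Kinf_alpha; have [Kd _] := class_Kinf_decay.
have Kz := class_Kinf_decay_alpha.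
have at0 := class_K_ge0 Ka D0.
have da : decay (alpha t) <= decay v by exact: class_K_le.
have k0 : 0 <= k%:R :> R by [].
have k1 : 0 < 1 + k%:R :> R by lra.
rewrite /attraction -[leLHS](inv_KinfK Kz D0).
have [Kiz _] := class_Kinf_inv Kz.
apply: (class_K_le Kiz); first exact: class_K_ge0 Kz.1 D0.
rewrite ler_pdivlMr//; nra.
Qed.

Lemma cl_dist_le N j X k : (N0 <= N)%N -> Y N j X ->
  D (j + k) (cl N j X k) <=
  Num.max (attraction (D j X) k%:R) (inv_Kinf alpha (delta N%:R)).
Proof.
move=> NN YX; rewrite le_max; apply/orP.
have [Qk|nQ] := pselect (Q N (j + k)%N (cl N j X k)); last first.
  by left; exact: cl_dist_off_target.
right; have Yk := target_sublevel NN Qk.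
have [WE aW _ _] := sublevel_value NN Yk; have [sk _] := Yk.
have /(sublevelE _ sk WE) Wd := Qk.
have [_ /andP[D0 _]] := sublevel_distE NN Yk.
have Ka := class_Kinf_alpha; have [Kia _] := class_Kinf_inv Ka.
rewrite -[leLHS](inv_KinfK Ka D0); apply: class_K_le => //.
  by apply: class_K_ge0 => //; case: Ka.
exact: le_trans Wd.
Qed.

Definition cl_controls N j X k := mu N (j + k)%N (cl N j X k).

Lemma traj_cl N j X k : traj S j X (cl_controls N j X) k = cl N j X k.
Proof. by elim: k => //= k ->. Qed.

Lemma tJ_cl_le N j X K : (N0 <= N)%N -> Y N j X ->
  (tJ K j X (cl_controls N j X) + tV N (j + K) (cl N j X K) <=
   tV N j X + (K%:R * err N)%:E)%E.
Proof.
move=> NN YX; elim: K => [|K IH].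
  by rewrite /Defs.tJ big_ord0 add0e addn0 mul0r adde0.
have YK := sublevel_cl_traj K NN YX.
rewrite /Defs.tJ big_ord_recr/= traj_cl -/(Defs.tJ _ _ _ _ _ _ _ _).
rewrite -addeA addnS; apply: le_trans (leeD2l _ (decrease NN YK)) _.
rewrite addeA; apply: le_trans (leeD2r _ IH) _.
by rewrite -addeA -EFinD -natr1 mulrDl mul1r.
Qed.

Lemma ell_cl_fin_num N X k : (N0 <= N)%N -> Y N 0%N X ->
  ell S (cl N 0 X k) (mu N k (cl N 0 X k)) \is a fin_num.
Proof.
move=> NN YX; have Yk := sublevel_cl_traj k NN YX; rewrite add0n in Yk.
have [_ TE _ _ _] := sublevel_next NN Yk.
by rewrite (ell_tell k) TE.
Qed.

(** The closed loop here and its competitors in [J_ge_near] are compared with the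
    same reference [tV N 0 X - lam 0 X + K * ls + lam K (Xs K)]; apart from the
    accumulated error, the remaining terms depend only on the distances reached
    at time [K]. *)
Lemma Jcl_le N X K rho : (N0 <= N)%N -> Y N 0%N X -> rho <= teps ->
  D K (cl N 0 X K) <= rho ->
  (Jcl S (mu N) K X <= (W N 0 X + K%:R * err N + K%:R * ls - lam 0 X
     + lam K (Xs K) + glam rho)%:E)%E.
Proof.
move=> NN YX kte Dk; have := tJ_cl_le K NN YX; rewrite add0n.
have YK := sublevel_cl_traj K NN YX; rewrite add0n in YK.
have [WE _ _ _] := sublevel_value NN YX; have [sK _] := YK.
have [WKE aWK _ _] := sublevel_value NN YK.
have [dKE /andP[DK0 _]] := sublevel_distE NN YK.
have aK0 : 0 <= alpha (D K (cl N 0 X K)).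
  by apply: class_K_ge0 => //; case: class_Kinf_alpha.
have -> : Jcl S (mu N) K X = J S K 0 X (cl_controls N 0 X).
  by apply: eq_bigr => i _; rewrite traj_cl.
rewrite J_tJ WE WKE add0n traj_cl -EFinD -leeBrDr// -EFinB.
move=> /leeD2r h; apply: le_trans (h _) _; rewrite -EFinD lee_fin.
have : `|lam K (cl N 0 X K) - lam K (Xs K)| <= glam rho.
  by apply: lam_near => //; split=> //; rewrite dKE lee_fin.
rewrite ler_norml => /andP[_ ?]; lra.
Qed.

(** The rotated cost of [U], prolonged almost optimally by [N] steps, is at least
    [tV N 0 X], and the prolongation costs at most [gtV rho]. *)
Lemma J_ge_near N X K U rho : (N0 <= N)%N -> Y N 0%N X -> adm_seq S K 0 X U ->
  rho <= teps -> cball S Xs d rho%:E K (traj S 0 X U K) ->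
  ((W N 0 X - gtV rho + K%:R * ls - lam 0 X + lam K (Xs K) - glam rho)%:E
   <= J S K 0 X U)%E.
Proof.
move=> NN YX aU kte bU; have [sX _] := YX.
have [WE _ _ _] := sublevel_value NN YX.
have := lam_near kte bU; rewrite ler_norml => /andP[hl _].
rewrite J_tJ add0n; have tJ0 := tJ_ge0 sX aU.
have [->|tJoo] := eqVneq (tJ K 0 X U) +oo%E; first by rewrite addye// leey.
have fU : tJ K 0 X U \is a fin_num by rewrite ge0_fin_numE// lt_neqAle tJoo leey.
have tVK : (tV N K (traj S 0 X U K) <= (gtV rho)%:E)%E.
  by apply: tV_le_radius => //; exact: le_trans htr.
have : (tV N 0 X <= tJ K 0 X U + (gtV rho)%:E)%E.
  apply: le_trans (tV_homo sX (leq_addl K N)) _.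
  apply: le_trans (opt_cost_splice N aU fU) _.
  by rewrite add0n leeD2l.
rewrite WE -(fineK fU) -!EFinD !lee_fin; lra.
Qed.

Lemma sum_ell_sub N X K U : (N0 <= N)%N -> Y N 0%N X ->
  (\sum_(k < K) (ell S (traj S 0 X U k) (U k)
     - ell S (cl N 0 X k) (mu N k (cl N 0 X k))) =
   J S K 0 X U - Jcl S (mu N) K X)%E.
Proof.
move=> NN YX; rewrite /J /Jcl; elim: K => [|K IH].
  by rewrite !big_ord0 sube0.
rewrite !big_ord_recr/= IH addeACA oppeD//.
by rewrite fin_num_adde_defl// ell_cl_fin_num.
Qed.

(** The rotated cost of prolonging a competitor, and one difference of storage
    values for the competitor and one for the closed loop. *)
Definition loss (x : R) : R := gtV x + 2 * glam x.

Lemma class_K_loss : class_K loss.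
Proof.
by case: KgtV => Kg _; apply: class_K_add => //; exact: class_K_scale.
Qed.

Lemma loss_max x y : 0 <= x -> 0 <= y -> loss (Num.max x y) <= loss x + loss y.
Proof.
move=> x0 y0; have := class_K_ge0 class_K_loss x0.
have := class_K_ge0 class_K_loss y0.
by case: (leP x y) => _ ? ?; lra.
Qed.

Lemma glam_le_loss x : 0 <= x -> glam x <= loss x.
Proof.
move=> x0; have := class_K_ge0 Kglam x0; have := class_K_ge0 KgtV.1 x0.
by rewrite /loss; lra.
Qed.

Let K_attr (t : R) : 0 <= t -> class_K (attraction ^~ t).
Proof. by case: class_KL_attraction => _ + _; apply. Qed.

Lemma near_optimal N K X : (N0 <= N)%N -> Y N 0%N X ->
  attraction radius K%:R <= teps -> inv_Kinf alpha (delta N%:R) <= teps ->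
  let kappa := Order.max (er_map (attraction ^~ K%:R) (dist 0%N X))
                 (inv_Kinf alpha (delta N%:R))%:E in
  (Jcl S (mu N) K X <=
   ereal_inf [set J S K 0 X U | U in
     [set U | adm_seq S K 0 X U /\ cball S Xs d kappa K (traj S 0 X U K)]]
   + (loss (inv_Kinf alpha (delta N%:R)) + K%:R * err N +
      loss (attraction radius K%:R))%:E)%E.
Proof.
move=> NN YX attr_te inv_te.
have [dE /andP[D0 Dr]] := sublevel_distE NN YX.
rewrite dE [er_map _ _]/= -EFin_max.
set a := attraction _ K%:R; set b := inv_Kinf alpha _.
have KK0 : 0 <= K%:R :> R by [].
have a0 : 0 <= a by apply: class_K_ge0 (K_attr KK0) D0.
have b0 : 0 <= b by apply: inv_Kinf_ge0; [exact: class_Kinf_alpha|exact: delta_ge0].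
have ar : a <= attraction radius K%:R by apply: class_K_le (K_attr KK0) D0 Dr.
have kte : Num.max a b <= teps by rewrite ge_max inv_te (le_trans ar).
cbv zeta; rewrite -leeBlDr//; apply: le_ereal_inf_tmp => _ [U [aU bU] <-].
rewrite leeBlDr//.
apply: le_trans (Jcl_le NN YX kte _) _.
  by have := cl_dist_le K NN YX; rewrite add0n.
apply: le_trans (leeD2r _ (J_ge_near NN YX aU kte bU)).
rewrite -EFinD lee_fin; have := loss_max a0 b0.
have : loss a <= loss (attraction radius K%:R) by apply: class_K_le class_K_loss _ ar.
have : loss (Num.max a b) = gtV (Num.max a b) + 2 * glam (Num.max a b) by [].
lra.
Qed.

(** If the rotated cost of the competitor is unbounded, the competitor loses by
    an arbitrarily large amount; otherwise its distance to the stationary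
    process tends to zero, and it can be compared with the closed loop as an
    admissible competitor in the problem with terminal constraint. *)
Lemma overtaking_near_optimal N X U : (N0 <= N)%N -> Y N 0%N X ->
  adm_seq_inf S 0 X U -> 0 < teps -> inv_Kinf alpha (delta N%:R) <= teps ->
  forall e, 0 < e -> exists n, forall K, (n <= K)%N ->
    ((- e)%:E <= \sum_(k < K) (ell S (traj S 0 X U k) (U k)
        - ell S (cl N 0 X k) (mu N k (cl N 0 X k))) +
      (K%:R * err N + loss (inv_Kinf alpha (delta N%:R)))%:E)%E.
Proof.
move=> NN YX aU te0 inv_te e e0.
have aUK K : adm_seq S K 0 X U by move=> k _; exact: aU.
have [sX _] := YX; have [dE /andP[D0 Dr]] := sublevel_distE NN YX.
set b := inv_Kinf alpha _ in inv_te *.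
have b0 : 0 <= b by apply: inv_Kinf_ge0; [exact: class_Kinf_alpha|exact: delta_ge0].
have Lattr : class_L (attraction radius).
  by case: class_KL_attraction => _ _; apply.
have [n1 Hn1] := class_L_nat_lim Lattr te0.
have e4 : 0 < e / 4 by rewrite divr_gt0.
have [n2 Hn2] := class_L_nat_lim (class_L_comp class_K_loss Lattr) e4.
pose kap K := Num.max (attraction (D 0%N X) K%:R) b.
have kapP K : (n1 <= K)%N -> (n2 <= K)%N ->
    [/\ kap K <= teps, D K (cl N 0 X K) <= kap K & glam (kap K) <= loss b + e / 4].
  move=> /Hn1 K1 /Hn2 /= K2; have KK0 : 0 <= K%:R :> R by [].
  have a0 : 0 <= attraction (D 0%N X) K%:R by apply: class_K_ge0 (K_attr KK0) D0.
  have ar : attraction (D 0%N X) K%:R <= attraction radius K%:R.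
    exact: class_K_le (K_attr KK0) D0 Dr.
  split; first by rewrite ge_max inv_te (le_trans ar).
    by have := cl_dist_le K NN YX; rewrite add0n.
  apply: le_trans (glam_le_loss _) _; first by rewrite le_max b0 orbT.
  have := loss_max a0 b0; have := class_K_le class_K_loss a0 ar.
  rewrite /kap; lra.
have [[B HB]|unb] := pselect (exists B : R, forall K, (tJ K 0 X U <= B%:E)%E).
  have [Ka _] := class_Kinf_alpha.
  have [t t0 Ht] := class_K_small class_K_loss e4.
  pose rho := Num.min t teps; have rho0 : 0 < rho by rewrite lt_min t0.
  have sk k : state S k (traj S 0 X U k).
    by have := state_traj hS sX (aUK k) (leqnn k).
  have [n3 Hn3] : exists n, forall k, (n <= k)%N ->
      (er_map alpha (dist k (traj S 0 X U k)) <= (alpha rho)%:E)%E.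
    apply: (@bounded_sum_small _ _ B).
    - by move=> k; apply: alpha_dist_ge0; exact: sk.
    - by move=> n; apply: le_trans (HB n); exact: (sum_alpha_dist_le_tJ sX (aUK n)).
    - exact: class_K_gt0.
  exists (maxn n1 (maxn n2 n3)) => K; rewrite !geq_max => /and3P[K1 K2 /Hn3 K3].
  have [kte Dk glamk] := kapP K K1 K2.
  have bU : cball S Xs d rho%:E K (traj S 0 X U K).
    split; first exact: sk.
    have ar0 := class_K_ge0 Ka (ltW rho0).
    have := er_map_le_inv class_Kinf_alpha (dist_ge0 (sk K)) ar0 K3.
    by rewrite (inv_KinfK class_Kinf_alpha (ltW rho0)).
  have rte : rho <= teps by rewrite ge_min lexx orbT.
  have lossr : loss rho <= e / 4.
    by apply: Ht; rewrite ltW// ge_min lexx.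
  have := J_ge_near NN YX (aUK K) rte bU; have := Jcl_le NN YX kte Dk.
  rewrite sum_ell_sub// => up lo.
  apply: le_trans (leeD2r _ (leeB lo up)); rewrite -EFinB -EFinD lee_fin.
  have := class_K_ge0 Kglam (ltW rho0).
  have : loss rho = gtV rho + 2 * glam rho by [].
  lra.
pose B := W N 0 X + Claml + Clam.
have [n3 Hn3] : exists n, (B%:E <= tJ n 0 X U)%E.
  apply: contrapT => /forallNP H; apply: unb; exists B => K.
  by apply/ltW; rewrite ltNge; apply/negP; exact: H.
exists (maxn n1 (maxn n2 n3)) => K; rewrite !geq_max => /and3P[K1 K2 K3].
have YK := sublevel_cl_traj K NN YX; rewrite add0n in YK.
have [kte Dk glamk] := kapP K K1 K2.
have lo : ((B + (K%:R * ls - lam 0 X - Claml))%:E <= J S K 0 X U)%E.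
  rewrite J_tJ EFinD; apply: leeD.
    by apply: le_trans Hn3 _; exact: tJ_homo.
  by rewrite lee_fin; have := hlam_lower (state_traj hS sX (aUK K) (leqnn K)); lra.
have up := Jcl_le NN YX kte Dk.
rewrite sum_ell_sub//.
apply: le_trans (leeD2r _ (leeB lo up)); rewrite -EFinB -EFinD lee_fin.
have := hlam_bound (cball_stationary K (ltW hr)); rewrite ler_norml => /andP[_ ?].
rewrite /B; lra.
Qed.

End closed_loop_analysis.

End cost_vanishes_at_stationary.
End rotation.
(** * The error tends to zero *)

Section turnpike_error.
Context {R : realType}.
Variables (alpha gtV glam : R -> R) (gV : R -> R -> R) (C : R).
Hypotheses (Kalpha : class_Kinf alpha) (KgtV : class_K gtV).
Hypotheses (Kglam : class_K glam) (C0 : 0 < C).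

(** The distance at which trajectories of horizon [N] with rotated cost at most
    [C] are found somewhere in the first half of the horizon. *)
Definition turnpike_radius (N : nat) : R := inv_Kinf alpha (C / (N%:R / 12)).

(** The rotated value behind the cut, and the differences of the storage function
    and of the original value at the two points where trajectories are cut. *)
Definition decrease_error (N : nat) : R :=
  gtV (turnpike_radius N) + 2 * glam (turnpike_radius N)
  + 2 * gV (N%:R / 2) (turnpike_radius N).

Lemma turnpike_radius_ge0 N : 0 <= turnpike_radius N.
Proof. by apply: inv_Kinf_ge0 => //; rewrite !divr_ge0// ltW. Qed.

Lemma turnpike_radius_small e : 0 < e ->
  exists M, forall N, (M <= N)%N -> turnpike_radius N <= e.
Proof.
move=> e0; have [Ka _] := Kalpha; have ae0 := class_K_gt0 Ka e0.
have c0 : 0 <= 12 * C / alpha e by rewrite divr_ge0 ?mulr_ge0 ?ltW.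
exists (Num.bound (12 * C / alpha e)).+1 => N MN.
have [Kia _] := class_Kinf_inv Kalpha.
rewrite /turnpike_radius -[leRHS](inv_KinfK Kalpha (ltW e0)).
apply: (class_K_le Kia); first by rewrite !divr_ge0// ltW.
have : (Num.bound (12 * C / alpha e))%:R <= N%:R :> R.
  by rewrite ler_nat; exact: ltnW.
move/(lt_le_trans (archi_boundP c0)); rewrite ltr_pdivrMr// => h.
have N0 : 0 < N%:R :> R by rewrite ltr0n; exact: leq_trans MN.
by rewrite ler_pdivrMr ?divr_gt0//; lra.
Qed.

Hypothesis hgV_ge0 : forall N rho, 0 <= N -> 0 <= rho -> 0 <= gV N rho.

Lemma decrease_error_ge0 N : 0 <= decrease_error N.
Proof.
have rho0 := turnpike_radius_ge0 N.
have N2 : 0 <= N%:R / 2 :> R by rewrite divr_ge0.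
have := class_K_ge0 KgtV rho0; have := class_K_ge0 Kglam rho0.
by have := hgV_ge0 N2 rho0; rewrite /decrease_error; lra.
Qed.

Hypothesis hgV_lim : forall e, 0 < e -> exists M rho0, [/\ 0 <= M, 0 < rho0 &
  forall N rho, M <= N -> 0 <= rho <= rho0 -> gV N rho <= e].

Lemma decrease_error_small e : 0 < e ->
  exists M, forall N, (M <= N)%N -> decrease_error N <= e.
Proof.
move=> e0; have e5 : 0 < e / 5 by rewrite divr_gt0.
have [t1 t10 H1] := class_K_small KgtV e5.
have [t2 t20 H2] := class_K_small Kglam e5.
have [M [t3 [M0 t30 H3]]] := hgV_lim e5.
have [n Hn] : exists n, forall N, (n <= N)%N ->
    turnpike_radius N <= Num.min t1 (Num.min t2 t3).
  by apply: turnpike_radius_small; rewrite !lt_min t10 t20.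
have M2 : 0 <= 2 * M by rewrite mulr_ge0.
exists (maxn n (Num.bound (2 * M))) => N; rewrite geq_max => /andP[/Hn + MN].
have rho0 := turnpike_radius_ge0 N.
rewrite !le_min => /and3P[r1 r2 r3].
have hM : M <= N%:R / 2.
  have : (Num.bound (2 * M))%:R <= N%:R :> R by rewrite ler_nat.
  by move/(lt_le_trans (archi_boundP M2)) => ?; lra.
have h1 : gtV (turnpike_radius N) <= e / 5 by apply: H1; rewrite rho0.
have h2 : glam (turnpike_radius N) <= e / 5 by apply: H2; rewrite rho0.
have h3 : gV (N%:R / 2) (turnpike_radius N) <= e / 5 by apply: H3 => //; rewrite rho0.
by rewrite /decrease_error; lra.
Qed.

(** Applied with [k] the inverse of [decay], this provides the target level. *)
Lemma class_L_error_majorant k : class_K k ->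
  exists2 l, class_L l &
    forall N, 2 * (k (2 * decrease_error N) + decrease_error N) <= l N%:R.
Proof.
move=> Kk; apply: class_L_majorant; apply/cvgrPdist_le => e e0.
have e4 : 0 < e / 4 by rewrite divr_gt0.
have [t t0 Ht] := class_K_small Kk e4.
have te : 0 < Num.min (t / 2) (e / 4) by rewrite lt_min e4 divr_gt0.
have [M HM] := decrease_error_small te.
exists M => // N /HM; rewrite le_min => /andP[h1 h2].
have err0 := decrease_error_ge0 N.
have err2 : 0 <= 2 * decrease_error N by rewrite mulr_ge0.
have k0 := class_K_ge0 Kk err2.
rewrite sub0r normrN ger0_norm; last by rewrite mulr_ge0// addr_ge0.
have : k (2 * decrease_error N) <= e / 4.
  by apply: Ht; rewrite err2/= mulrC -ler_pdivlMr.
by lra.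
Qed.

End turnpike_error.

(** * Near-optimality of the closed loop *)

Theorem corollary6p7
  (R : realType) (disp : measure_display) (Omega : measurableType disp)
  (P : probability Omega R) (XX UU WW : completeNormedModType R)
  (S : control_problem P XX UU WW)
  (PW : probability (g_sigma_algebraType (@open WW)) R)
  (hS : standing_assumptions S PW)
  (mu : nat -> nat -> (Omega -> XX) -> Omega -> UU)
  (hmu : mpc_feedback S mu)
  (d : (Omega -> XX) -> (Omega -> XX) -> \bar R)
  (hd : pseudometric_on (random_var XX) d)
  (Xs : nat -> Omega -> XX) (Us : nat -> Omega -> UU)
  (hs : stationary_pair S Xs Us)
  (hls : ell_s S Xs Us \is a fin_num)
  (* (1) *)
  (lam : nat -> (Omega -> XX) -> R) (alpha : R -> R)
  (hdiss : strictly_dissipative S Xs Us d lam alpha)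
  (* (2) *)
  (r CV Clam Claml : R)
  (hr : 0 < r) (hCV : 0 < CV) (hClam : 0 < Clam) (hClaml : 0 < Claml)
  (hlam_bound : forall j X, cball S Xs d r%:E j X -> `|lam j X| <= Clam)
  (hlam_lower : forall j X, state S j X -> - Claml <= lam j X)
  (hcheap : cheaply_reachable S Xs Us d r CV)
  (* (3) *)
  (eps : R) (heps : 0 < eps) (gV : R -> R -> R)
  (hgV_ge0 : forall N rho, 0 <= N -> 0 <= rho -> 0 <= gV N rho)
  (hgV_lim : forall e, 0 < e -> exists M rho0, [/\ 0 <= M, 0 < rho0 &
     forall N rho, M <= N -> 0 <= rho <= rho0 -> gV N rho <= e])
  (hgV_mono1 : forall rho N N', 0 <= rho -> 0 <= N -> N <= N' ->
     gV N' rho <= gV N rho)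
  (hgV_mono2 : forall N rho rho', 0 <= N -> 0 <= rho -> rho <= rho' ->
     gV N rho <= gV N rho')
  (hV : forall N j X, cball S Xs d eps%:E j X ->
     (`|V S N j X - V S N j (Xs j)| <= er_map (gV N%:R) (d X (Xs j)))%E)
  (* (4) *)
  (htell0 : forall j, tell S Xs Us lam j (Xs j) (Us j) = 0%E)
  (* (5) *)
  (tr teps : R) (htr : teps <= tr) (hteps : 0 < teps) (glam gtV : R -> R)
  (hglam : class_Kinf glam) (hgtV : class_Kinf gtV)
  (hlam : forall j X, cball S Xs d teps%:E j X ->
     (`|lam j X - lam j (Xs j)|%:E <= er_map glam (d X (Xs j)))%E)
  (htV : forall N j X, cball S Xs d tr%:E j X ->
     (`|tV S Xs Us lam N j X - tV S Xs Us lam N j (Xs j)|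
        <= er_map gtV (d X (Xs j)))%E)
  (* (6) *)
  (ehat : R) (hehat : 0 < ehat) (gVinf : R -> R) (hgVinf : class_K gVinf)
  (hVinf : forall j X, cball S Xs d ehat%:E j X ->
     (`|hV_inf S Xs Us j X - hV_inf S Xs Us j (Xs j)|
        <= er_map gVinf (d X (Xs j)))%E) :
  let theta (L : R) := inv_Kinf alpha ((Clam + Claml + CV) / L) in
  let nu (N : nat) : R :=
    8 * gtV (theta (N%:R / 12)) + 4 * glam (theta (N%:R / 12))
    + 4 * gV (N%:R / 2) (theta (N%:R / 12)) in
  exists (theta0 : R) (N0 : nat) (delta : R -> R) (beta : R -> R -> R)
         (delta2 delta3 : R -> R),
  let Y N := sublevel S Xs Us lam N theta0 in
  let Q N := sublevel S Xs Us lam N (delta N%:R) in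
  [/\ [/\ 0 < theta0, class_L delta, class_KL beta, class_L delta2 &
          class_L delta3],
  (* (P1) *)
      (forall N, (N0 <= N)%N ->
        [/\ forward_invariant S (mu N) (Y N), forward_invariant S (mu N) (Q N) &
            lyapunov S Xs d (mu N) (fun j => Y N j `\` Q N j)
              (tV S Xs Us lam N)]),
  (* (P2) *)
      (forall N j0 j X, (N0 <= N)%N -> Y N j0 X ->
        ~ Q N (j0 + j)%N (cl_traj S (mu N) j0 X j) ->
        (d (cl_traj S (mu N) j0 X j) (Xs (j + j0)%N)
           <= er_map (beta ^~ j%:R) (d X (Xs j0)))%E),
  (* (P3) *)
      (exists M : nat, forall N K X0, (M <= N)%N -> (M <= K)%N -> Y N 0%N X0 ->
        let kappa := Order.max (er_map (beta ^~ K%:R) (d X0 (Xs 0%N)))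
                               (inv_Kinf alpha (delta N%:R))%:E in
        (Jcl S (mu N) K X0 <=
           ereal_inf [set J S K 0 X0 U | U in
             [set U | adm_seq S K 0 X0 U /\
                      cball S Xs d kappa K (traj S 0 X0 U K)]]
           + (delta2 N%:R + K%:R * nu N + delta3 K%:R)%:E)%E) &
      (exists M : nat, forall N X0 U, (M <= N)%N -> Y N 0%N X0 ->
        adm_seq_inf S 0 X0 U ->
        (0 <= limn_einf (fun K : nat =>
           \sum_(j < K) (ell S (traj S 0 X0 U j) (U j)
              - ell S (cl_traj S (mu N) 0 X0 j)
                      (mu N j (cl_traj S (mu N) 0 X0 j)))
           + (K%:R * nu N + delta2 N%:R)%:E))%E)].
Proof.
move=> theta nu; have [_ Kalpha _] := hdiss.
have [Ka _] := Kalpha; have [KgtV _] := hgtV; have [Kglam _] := hglam.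
pose C := Clam + Claml + CV.
have C0 : 0 < C by rewrite !addr_gt0.
(* within this radius all local hypotheses are available *)
pose radius : R := Num.min r (Num.min eps teps).
have radius_gt0 : 0 < radius by rewrite !lt_min hr heps.
have radius_r : radius <= r by rewrite ge_min lexx.
have radius_eps : radius <= eps by rewrite !ge_min lexx orbT.
have radius_teps : radius <= teps by rewrite !ge_min lexx !orbT.
have radius_tr : radius <= tr by exact: le_trans htr.
clearbody radius.
have ar0 : 0 < alpha radius by exact: class_K_gt0.
(* [C / 2] leaves room for almost-minimizers with rotated cost at most [C] *)
pose th0 : R := Num.min (alpha radius) (C / 2).
have th0_gt0 : 0 < th0 by rewrite lt_min ar0 divr_gt0.
have th0_radius : th0 <= alpha radius by rewrite ge_min lexx.
have th0_C : th0 <= C / 2 by rewrite ge_min lexx orbT.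
clearbody th0.
pose err := decrease_error alpha gtV glam gV C.
have err_ge0 N : 0 <= err N by exact: decrease_error_ge0.
have err_nu N : err N <= nu N.
  have rho0 := turnpike_radius_ge0 Kalpha C0 N.
  have N2 : 0 <= N%:R / 2 :> R by rewrite divr_ge0.
  have g1 := class_K_ge0 KgtV rho0; have g2 := class_K_ge0 Kglam rho0.
  have g3 := hgV_ge0 _ _ N2 rho0.
  rewrite /err /decrease_error /nu /theta -/C -/(turnpike_radius alpha C N).
  by lra.
have Kdecay := class_Kinf_decay hdiss hgtV.
have [Kidecay _] := class_Kinf_inv Kdecay.
have [delta Ldelta delta_err'] :=
  class_L_error_majorant Kalpha KgtV Kglam C0 hgV_ge0 hgV_lim Kidecay.
have [n1 Hn1] := turnpike_radius_small Kalpha C0 radius_gt0.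
have [n2 Hn2] := class_L_nat_lim Ldelta th0_gt0.
pose N0 := maxn 2 (maxn n1 n2).
have N0P N : (N0 <= N)%N -> [/\ (2 <= N)%N, (n1 <= N)%N & (n2 <= N)%N].
  by rewrite !geq_max => /and3P.
have N0_gt0 : (0 < N0)%N by rewrite leq_max.
clearbody N0.
have delta_th0 N : (N0 <= N)%N -> delta N%:R <= th0.
  by move=> /N0P[_ _ /Hn2].
have delta_err N : (N0 <= N)%N ->
    2 * (inv_Kinf (decay alpha gtV) (2 * err N) + err N) <= delta N%:R.
  by move=> _; exact: delta_err'.
have decrease N j X : (N0 <= N)%N -> sublevel S Xs Us lam N th0 j X ->
    (tell S Xs Us lam j X (mu N j X) + tV S Xs Us lam N j.+1 (cl_step S (mu N) j X)
     <= tV S Xs Us lam N j X + (err N)%:E)%E.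
  move=> NN YX; have [N2 /Hn1 rhoN _] := N0P _ NN.
  have [sX dX] := sublevel_cball hS hd hs hdiss radius_gt0 th0_radius N0_gt0 NN YX.
  have [U mU muE] := hmu _ _ _ (leq_trans N0_gt0 NN) sX.
  rewrite /cl_step muE; apply: (rotated_value_decrease hS hd hs hls hdiss htell0
    hgtV htV hr hCV hClam hClaml hlam_bound hlam_lower hcheap htr Kglam hlam
    hgV_mono1 hgV_mono2 hV) => //.
  - exact: le_trans rhoN radius_eps.
  - exact: le_trans rhoN radius_teps.
  - by split=> //; apply: le_trans dX _; rewrite lee_fin.
  - by case: YX => _ /andP[_]; move/le_trans; apply; rewrite lee_fin.
have KLattr := class_KL_attraction hdiss hgtV.
have Kloss := class_K_loss hgtV Kglam.
have Linv : class_L (inv_Kinf alpha \o delta).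
  by apply: class_L_comp => //; case: (class_Kinf_inv Kalpha).
have Lattr : class_L (attraction alpha gtV radius) by case: KLattr => _ _; apply.
have [m1 Hm1] := class_L_nat_lim Linv hteps.
have [m2 Hm2] := class_L_nat_lim Lattr hteps.
have distE := sublevel_distE hS hd hs hdiss radius_gt0 th0_radius N0_gt0.
exists th0, N0, delta, (attraction alpha gtV),
  (loss gtV glam \o (inv_Kinf alpha \o delta)),
  (loss gtV glam \o attraction alpha gtV radius) => Y Q; split.
- by split=> //; exact: class_L_comp.
- move=> N NN; split.
  + exact: (sublevel_invariant hS hd hs hdiss htell0 hgtV htV hmu radius_gt0
      radius_tr th0_radius N0_gt0 err_ge0 decrease delta_th0 delta_err NN).
  + exact: (target_invariant hS hd hs hdiss htell0 hgtV htV hmu radius_gt0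
      radius_tr th0_radius N0_gt0 err_ge0 decrease delta_th0 delta_err NN).
  + exact: (lyapunov_off_target hS hd hs hdiss htell0 hgtV htV hmu radius_gt0
      radius_tr th0_radius N0_gt0 err_ge0 decrease delta_err NN).
- move=> N j0 j X NN YX nQ.
  have [dE _] := distE _ _ _ NN YX.
  have Yj := sublevel_cl_traj hS hd hs hdiss htell0 hgtV htV hmu radius_gt0
    radius_tr th0_radius N0_gt0 err_ge0 decrease delta_th0 delta_err j NN YX.
  have [djE _] := distE _ _ _ NN Yj.
  rewrite dE addnC djE lee_fin.
  exact: (cl_dist_off_target hS hd hs hdiss htell0 hgtV htV hmu radius_gt0
    radius_tr th0_radius N0_gt0 err_ge0 decrease delta_th0 delta_err NN YX nQ).
- exists (maxn N0 (maxn m1 m2)) => N K X.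
  rewrite !geq_max => /and3P[NN /Hm1 b_te _] /and3P[_ _ /Hm2 a_te] YX; cbv zeta.
  have := near_optimal hS hd hs hls hdiss htell0 hgtV htV htr Kglam hlam
    hmu radius_gt0 radius_tr th0_radius N0_gt0 err_ge0 decrease delta_th0 delta_err
    NN YX a_te b_te.
  cbv zeta => /le_trans; apply.
  by rewrite leeD2l// lee_fin lerD2r lerD2l ler_wpM2l.
- exists (maxn N0 m1) => N X U; rewrite geq_max => /andP[NN /Hm1 b_te] YX aU.
  apply: limn_einf_ge0 => e e0.
  have [n Hn] := overtaking_near_optimal hS hd hs hls hdiss htell0 hgtV htV hr
    hlam_bound hlam_lower htr Kglam hlam hmu radius_gt0 radius_tr th0_radius N0_gt0
    err_ge0 decrease delta_th0 delta_err NN YX aU hteps b_te e0.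
  exists n => K /Hn /le_trans; apply; rewrite leeD2l// lee_fin lerD2r.
  by rewrite ler_wpM2l.
Qed.
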